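(* The morphisms $\beta_{\uparrow_{\mathsf a},\uparrow_{\mathsf b}}$, for $\mathsf a,\mathsf b$ ranging over tuples of nonnegative integers, define a symmetric braiding on the monoidal supercategory $\mathfrak{q}\text{-}\mathbf{Web}_{\uparrow}$.
   Context: **Conventions.** The ground field is $\mathbb{C}$. A supercategory is a category enriched in superspaces ($\mathbb Z_2$-graded vector spaces). In a monoidal supercategory $(f\otimes g)\circ(h\otimes k)=(-1)^{|g||h|}(f\circ h)\otimes(g\circ k)$. A braiding on a monoidal supercategory $\mathcal A$ is a supernatural isomorphism from $-\otimes-$ to the functor $(\mathsf a,\mathsf b)\mapsto\mathsf b\otimes\mathsf a$, $f\otimes g\mapsto(-1)^{|f||g|}g\otimes f$, satisfying the hexagon axioms; it is symmetric if $\gamma_{\mathsf a,\mathsf b}^{-1}=\gamma_{\mathsf b,\mathsf a}$. **Upward webs.** $\mathfrak{q}\text{-}\mathbf{Web}_{\uparrow}$ is the strict monoidal supercategory with generating objects $\uparrow_k$ ($k\ge 0$; $\uparrow_0$ is identified with the unit object) and generating morphisms, for $k,l\ge1$: the odd dot $d_k:\uparrow_k\to\uparrow_k$, the even merge $m_{k,l}:\uparrow_k\uparrow_l\to\uparrow_{k+l}$, the even split $s_{k,l}:\uparrow_{k+l}\to\uparrow_k\uparrow_l$. Edges labelled $0$ are omitted (so $m_{k,0},m_{0,k},s_{k,0},s_{0,k}$ are identities, $d_0=0$), and a composite involving a negative label is $0$. Write $1_k$ for the identity of $\uparrow_k$. On $\uparrow_k\uparrow_l$ define ladders $E^{(j)}=(m_{k,j}\otimes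 1_{l-j})(1_k\otimes s_{j,l-j})$, $F^{(j)}=(1_{k-j}\otimes m_{j,l})(s_{k-j,j}\otimes 1_l)$, $E=E^{(1)}$, $F=F^{(1)}$, and dotted ladders $\bar E=(m_{k,1}\otimes 1_{l-1})(1_k\otimes d_1\otimes 1_{l-1})(1_k\otimes s_{1,l-1})$, $\bar F=(1_{k-1}\otimes m_{1,l})(1_{k-1}\otimes d_1\otimes 1_l)(s_{k-1,1}\otimes 1_l)$. On three strands $\uparrow_h\uparrow_k\uparrow_l$, a subscript $1$ (resp. $2$) means that the ladder is applied to the first two (resp. last two) strands. Relations, for all labels: (1) associativity $m_{h+k,l}(m_{h,k}\otimes1_l)=m_{h,k+l}(1_h\otimes m_{k,l})$ and $(s_{h,k}\otimes1_l)s_{h+k,l}=(1_h\otimes s_{k,l})s_{h,k+l}$; (2) $m_{k,l}s_{k,l}=\binom{k+l}{l}1_{k+l}$; (3) $d_k^2=k\,1_k$; (4) $d_{k+l}m_{k,l}=m_{k,l}(d_k\otimes1_l+1_k\otimes d_l)$, $s_{k,l}d_{k+l}=(d_k\otimes1_l+1_k\otimes d_l)s_{k,l}$; (5) $s_{1,1}m_{1,1}-(d_1\otimes d_1)s_{1,1}m_{1,1}(d_1\otimes d_1)=2\cdot 1_1\otimes1_1$; (6) $EF-FE=(k-l)\,1_k\otimes1_l$ on $\uparrow_k\uparrow_l$; (7) $\bar EF-F\bar E=d_k\otimes1_l-1_k\otimes d_l=E\bar F-\bar FE$ on $\uparrow_k\uparrow_l$; (8) $E_1E_2-E_2E_1=\bar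 E_1\bar E_2+\bar E_2\bar E_1$, $F_2F_1-F_1F_2=\bar F_1\bar F_2+\bar F_2\bar F_1$; (9) $E_1\bar E_2-\bar E_2E_1=\bar E_1E_2-E_2\bar E_1$, $F_1\bar F_2-\bar F_2F_1=\bar F_1F_2-F_2\bar F_1$. **Crossings.** The crossing on $\uparrow_1\uparrow_1$ is $x=s_{1,1}m_{1,1}-1_1\otimes1_1$. Let $m_k:\uparrow_1^k\to\uparrow_k$ and $s_k:\uparrow_k\to\uparrow_1^k$ be the iterated merge and split. Let $X_{k,l}\in\mathrm{End}(\uparrow_1^{k+l})$ be the composite of crossings $x$ of adjacent strands along a reduced word of the block permutation carrying the first $k$ strands past the last $l$ (independent of the word). Put $\beta_{\uparrow_k,\uparrow_l}=\frac1{k!\,l!}(m_l\otimes m_k)X_{k,l}(s_k\otimes s_l):\uparrow_k\uparrow_l\to\uparrow_l\uparrow_k$ for $k,l\geq1$ (identity if $k$ or $l$ is $0$). For tuples $\mathsf a=(a_1,\dots,a_r)$, $\mathsf b=(b_1,\dots,b_s)$ put $\uparrow_{\mathsf a}=\uparrow_{a_1}\cdots\uparrow_{a_r}$ and let $\beta_{\uparrow_{\mathsf a},\uparrow_{\mathsf b}}:\uparrow_{\mathsf a}\uparrow_{\mathsf b}\to\uparrow_{\mathsf b}\uparrow_{\mathsf a}$ be the composite of the crossings $\beta_{\uparrow_{a_i},\uparrow_{b_j}}$ in which all strands of $\mathsf a$ cross all strands of $\mathsf b$, each pair once, keeping the order within $\mathsf a$ and within $\mathsf b$. *)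

(* Defs.v *)
From HB Require Import structures.
From mathcomp Require Import all_boot all_order all_algebra.
From mathcomp Require Import generic_quotient.
From mathcomp Require Import boolp classical_sets reals.
From mathcomp Require Import complex zify.

Set Implicit Arguments.
Unset Strict Implicit.
Unset Printing Implicit Defensive.

Import Order.TTheory GRing.Theory Num.Theory.
Local Open Scope ring_scope.
Local Open Scope quotient_scope.

(* Parities are booleans, [true] being odd, and they add with [(+)]. In every *)
(* composite below the right-hand factor is applied first.                    *)

Record superspace (K : fieldType) := Superspace {
  sspace :> lmodType K;
  homog : bool -> set sspace;
  homog0 : forall p, homog p 0;
  homog_lin : forall p c (u v : sspace),
    homog p u -> homog p v -> homog p (c *: u + v);
  homog_dec : forall v : sspace,
    exists v0 v1, [/\ homog false v0, homog true v1 & v = v0 + v1];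
  homog_cap : forall v : sspace, homog false v -> homog true v -> v = 0
}.

Record supercategory (K : fieldType) := Supercategory {
  scobj :> Type;
  schom : scobj -> scobj -> superspace K;
  scid : forall a, schom a a;
  sccomp : forall a b c, schom b c -> schom a b -> schom a c;
  scid_even : forall a, homog false (scid a);
  sccomp_parity : forall a b c p q (f : schom b c) (g : schom a b),
    homog p f -> homog q g -> homog (p (+) q) (sccomp f g);
  sccomp_linl : forall a b c (g : schom a b),
    linear (fun f : schom b c => sccomp f g);
  sccomp_linr : forall a b c (f : schom b c),
    linear (fun g : schom a b => sccomp f g);
  sccompA : forall a b c d (f : schom c d) (g : schom b c) (h : schom a b),
    sccomp f (sccomp g h) = sccomp (sccomp f g) h;
  sccomp1l : forall a b (f : schom a b), sccomp (scid b) f = f;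
  sccomp1r : forall a b (f : schom a b), sccomp f (scid a) = f
}.

Arguments scid {K s} a.
Arguments sccomp {K s a b c} f g.

(* The identity morphism, seen between two equal objects. The structural      *)
(* isomorphisms of a strict monoidal supercategory are of this form.          *)
Definition eqhom (K : fieldType) (A : supercategory K) (a b : A) (e : a = b) :
    schom a b :=
  match e in _ = b' return schom a b' with erefl => scid a end.

Record strict_monoidal_supercategory (K : fieldType) :=
    StrictMonoidalSupercategory {
  smcat :> supercategory K;
  smunit : smcat;
  smobj : smcat -> smcat -> smcat;
  smtens : forall a b c d,
    schom a b -> schom c d -> schom (smobj a c) (smobj b d);
  smobjA : forall a b c, smobj (smobj a b) c = smobj a (smobj b c);
  smobj1l : forall a, smobj smunit a = a;
  smobj1r : forall a, smobj a smunit = a;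
  smtens_parity : forall a b c d p q (f : schom a b) (g : schom c d),
    homog p f -> homog q g -> homog (p (+) q) (smtens f g);
  smtens_linl : forall a b c d (g : schom c d),
    linear (fun f : schom a b => smtens f g);
  smtens_linr : forall a b c d (f : schom a b),
    linear (fun g : schom c d => smtens f g);
  smtens_id : forall a b, smtens (scid a) (scid b) = scid (smobj a b);
  smtens_interchange : forall a b c a' b' c' p q (f : schom b c)
      (g : schom b' c') (h : schom a b) (k : schom a' b'),
    homog p g -> homog q h ->
    sccomp (smtens f g) (smtens h k) =
      (-1) ^+ (p && q) *: smtens (sccomp f h) (sccomp g k);
  smtensA : forall a b c a' b' c' (f : schom a a') (g : schom b b')
      (h : schom c c'),
    sccomp (eqhom (smobjA a' b' c')) (smtens (smtens f g) h) =
      sccomp (smtens f (smtens g h)) (eqhom (smobjA a b c));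
  smtens1l : forall a b (f : schom a b),
    sccomp (eqhom (smobj1l b)) (smtens (scid smunit) f) =
      sccomp f (eqhom (smobj1l a));
  smtens1r : forall a b (f : schom a b),
    sccomp (eqhom (smobj1r b)) (smtens f (scid smunit)) =
      sccomp f (eqhom (smobj1r a))
}.

Arguments smobj {K s} a b.
Arguments smtens {K s a b c d} f g.

Section Braiding.
Context (K : fieldType) (A : strict_monoidal_supercategory K).
Context (gam : forall a b : A, schom (smobj a b) (smobj b a)).

Let assoc (a b c : A) := eqhom (smobjA a b c).
Let associ (a b c : A) := eqhom (esym (smobjA a b c)).

(* The components of the supernatural isomorphism are required to be even.    *)
Definition is_supernatural : Prop :=
  (forall a b, homog false (gam a b)) /\
  (forall a b c d p q (f : schom a c) (g : schom b d),
     homog p f -> homog q g ->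
     sccomp (gam c d) (smtens f g) =
       (-1) ^+ (p && q) *: sccomp (smtens g f) (gam a b)).

Definition is_isomorphism : Prop :=
  forall a b, exists g : schom (smobj b a) (smobj a b),
    sccomp g (gam a b) = scid _ /\ sccomp (gam a b) g = scid _.

Definition hexagon1 : Prop := forall a b c : A,
  sccomp (assoc b c a) (sccomp (gam a (smobj b c)) (assoc a b c)) =
    sccomp (smtens (scid b) (gam a c))
      (sccomp (assoc b a c) (smtens (gam a b) (scid c))).

Definition hexagon2 : Prop := forall a b c : A,
  sccomp (associ c a b) (sccomp (gam (smobj a b) c) (associ a b c)) =
    sccomp (smtens (gam a c) (scid b))
      (sccomp (associ a c b) (smtens (scid a) (gam b c))).

Definition is_braiding : Prop :=
  [/\ is_supernatural, is_isomorphism, hexagon1 & hexagon2].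

Definition is_symmetric_braiding : Prop :=
  is_braiding /\
  (forall a b, sccomp (gam b a) (gam a b) = scid (smobj a b) /\
               sccomp (gam a b) (gam b a) = scid (smobj b a)).

End Braiding.

(* The letter [n] of a word stands for the generating object with label       *)
(* [n.+1], so that the object with label 0 is the empty word, i.e. the unit.  *)

Definition wobj := seq nat.

Definition up (k : nat) : wobj := if k is n.+1 then [:: n] else [::].

Definition ups (a : seq nat) : wobj := flatten [seq up k | k <- a].

(* Formal expressions for morphisms; they denote morphisms when [wf] holds.   *)
Inductive term (K : Type) : Type :=
| Id of wobj
| Dot of nat
| Merge of nat & nat
| Split of nat & nat
| Cmp of term K & term K
| Tns of term K & term K
| Zero of wobj & wobj
| Add of term K & term K
| Scl of K & term K.

Arguments Id {K}.
Arguments Dot {K}.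
Arguments Merge {K}.
Arguments Split {K}.
Arguments Zero {K}.

Declare Scope web_scope.
Delimit Scope web_scope with W.
Bind Scope web_scope with term.
Notation "f ∘ g" := (Cmp f g) (at level 40, left associativity) : web_scope.
Notation "f ⊗ g" := (Tns f g) (at level 35, right associativity) : web_scope.
Notation "f + g" := (Add f g) : web_scope.
Notation "c *: f" := (Scl c f) : web_scope.
Notation "f - g" := (Add f (Scl (-1) g)) : web_scope.
Notation "\1_ k" := (Id (up k)) (at level 8, k at level 2, format "\1_ k") :
  web_scope.

Section Terms.
Context {K : Type}.

Fixpoint src (t : term K) : wobj :=
  match t with
  | Id a => a
  | Dot k => up k
  | Merge k l => up k ++ up l
  | Split k l => up (k + l)
  | Cmp f g => src g
  | Tns f g => src f ++ src g
  | Zero a _ => a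
  | Add f _ => src f
  | Scl _ f => src f
  end.

Fixpoint tgt (t : term K) : wobj :=
  match t with
  | Id a => a
  | Dot k => up k
  | Merge k l => up (k + l)
  | Split k l => up k ++ up l
  | Cmp f g => tgt f
  | Tns f g => tgt f ++ tgt g
  | Zero _ b => b
  | Add f _ => tgt f
  | Scl _ f => tgt f
  end.

Fixpoint wf (t : term K) : bool :=
  match t with
  | Id _ | Zero _ _ => true
  | Dot k => 0 < k
  | Merge k l | Split k l => (0 < k) && (0 < l)
  | Cmp f g => [&& wf f, wf g & src f == tgt g]
  | Tns f g => wf f && wf g
  | Add f g => [&& wf f, wf g, src f == src g & tgt f == tgt g]
  | Scl _ f => wf f
  end%N.

Definition parallel (t u : term K) : bool :=
  [&& wf t, wf u, src t == src u & tgt t == tgt u].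

(* [has_parity t p]: [t] is visibly homogeneous of parity [p].                *)
Fixpoint has_parity (t : term K) (p : bool) : bool :=
  match t with
  | Id _ | Merge _ _ | Split _ _ => ~~ p
  | Dot _ => p
  | Zero _ _ => true
  | Cmp f g | Tns f g => (has_parity f false && has_parity g p)
                         || (has_parity f true && has_parity g (~~ p))
  | Add f g => has_parity f p && has_parity g p
  | Scl _ f => has_parity f p
  end.

End Terms.

Section Presentation.
Context {K : fieldType}.
Implicit Types t u : term K.
Local Open Scope web_scope.

Inductive structural : term K -> term K -> Prop :=
| st_compA (f g h : term K) : structural (f ∘ (g ∘ h)) ((f ∘ g) ∘ h)
| st_comp1l f : structural (Id (tgt f) ∘ f) f
| st_comp1r f : structural (f ∘ Id (src f)) f
| st_tensA (f g h : term K) : structural (f ⊗ (g ⊗ h)) ((f ⊗ g) ⊗ h)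
| st_tens1l f : structural (Id [::] ⊗ f) f
| st_tens1r f : structural (f ⊗ Id [::]) f
| st_tens_id a b : structural (Id a ⊗ Id b) (Id (a ++ b))
| st_interchange (f g h k : term K) p q : has_parity g p -> has_parity h q ->
    structural ((f ⊗ g) ∘ (h ⊗ k))
               ((-1) ^+ (p && q) *: ((f ∘ h) ⊗ (g ∘ k)))
| st_addA f g h : structural (f + (g + h)) ((f + g) + h)
| st_addC f g : structural (f + g) (g + f)
| st_add0 f : structural (Zero (src f) (tgt f) + f) f
| st_addN f : structural (f - f) (Zero (src f) (tgt f))
| st_sclDr c f g : structural (c *: (f + g)) (c *: f + c *: g)
| st_sclDl (c d : K) f : structural ((c + d)%R *: f) (c *: f + d *: f)
| st_sclA (c d : K) f : structural (c *: (d *: f)) ((c * d)%R *: f)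
| st_scl1 f : structural (1 *: f) f
| st_compDl f g h : structural ((f + g) ∘ h) (f ∘ h + g ∘ h)
| st_compDr f g h : structural (f ∘ (g + h)) (f ∘ g + f ∘ h)
| st_compZl c f g : structural ((c *: f) ∘ g) (c *: (f ∘ g))
| st_compZr c f g : structural (f ∘ (c *: g)) (c *: (f ∘ g))
| st_tensDl f g h : structural ((f + g) ⊗ h) (f ⊗ h + g ⊗ h)
| st_tensDr f g h : structural (f ⊗ (g + h)) (f ⊗ g + f ⊗ h)
| st_tensZl c f g : structural ((c *: f) ⊗ g) (c *: (f ⊗ g))
| st_tensZr c f g : structural (f ⊗ (c *: g)) (c *: (f ⊗ g)).

Definition wdot (k : nat) : term K :=
  if (0 < k)%N then Dot k else Zero [::] [::].

Definition wmerge (k l : nat) : term K :=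
  if ((0 < k) && (0 < l))%N then Merge k l else \1_(k + l)%N.

Definition wsplit (k l : nat) : term K :=
  if ((0 < k) && (0 < l))%N then Split k l else \1_(k + l)%N.

(* Ladders on the strands k, l; they make sense for j <= l, resp. j <= k.     *)
Definition ladE (j k l : nat) : term K :=
  (wmerge k j ⊗ \1_(l - j)%N) ∘ (\1_k ⊗ wsplit j (l - j)%N).

Definition ladF (j k l : nat) : term K :=
  (\1_(k - j)%N ⊗ wmerge j l) ∘ (wsplit (k - j)%N j ⊗ \1_l).

Definition webE := ladE 1.
Definition webF := ladF 1.

Definition webdE (k l : nat) : term K :=
  (wmerge k 1 ⊗ \1_(l - 1)%N) ∘ (\1_k ⊗ wdot 1 ⊗ \1_(l - 1)%N)
    ∘ (\1_k ⊗ wsplit 1 (l - 1)%N).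

Definition webdF (k l : nat) : term K :=
  (\1_(k - 1)%N ⊗ wmerge 1 l) ∘ (\1_(k - 1)%N ⊗ wdot 1 ⊗ \1_l)
    ∘ (wsplit (k - 1)%N 1 ⊗ \1_l).

(* In the composites of two ladders below, the value is 0 when the label of   *)
(* an edge would be negative. Here one of P, Q is webE or webdE and the other *)
(* one is webF or webdF.                                                      *)
Definition comp_EF (P Q : nat -> nat -> term K) (k l : nat) : term K :=
  if (0 < k)%N then P k.-1 l.+1 ∘ Q k l else Zero (up k ++ up l) (up k ++ up l).

Definition comp_FE (P Q : nat -> nat -> term K) (k l : nat) : term K :=
  if (0 < l)%N then P k.+1 l.-1 ∘ Q k l else Zero (up k ++ up l) (up k ++ up l).

(* On three strands h, k, l: the composites P_1 Q_2 and P_2 Q_1, where P and  *)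
(* Q are both among webE, webdE (for 0 < l) or both among webF, webdF (for    *)
(* 0 < h).                                                                    *)
Definition comp_E1E2 (P Q : nat -> nat -> term K) (h k l : nat) : term K :=
  (P h k.+1 ⊗ \1_(l.-1)) ∘ (\1_h ⊗ Q k l).

Definition comp_E2E1 (P Q : nat -> nat -> term K) (h k l : nat) : term K :=
  if (0 < k)%N then (\1_(h.+1) ⊗ P k.-1 l) ∘ (Q h k ⊗ \1_l)
  else Zero (up h ++ up k ++ up l) (up h.+1 ++ up k ++ up l.-1).

Definition comp_F2F1 (P Q : nat -> nat -> term K) (h k l : nat) : term K :=
  (\1_(h.-1) ⊗ P k.+1 l) ∘ (Q h k ⊗ \1_l).

Definition comp_F1F2 (P Q : nat -> nat -> term K) (h k l : nat) : term K :=
  if (0 < k)%N then (P h k.-1 ⊗ \1_(l.+1)) ∘ (\1_h ⊗ Q k l)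
  else Zero (up h ++ up k ++ up l) (up h.-1 ++ up k ++ up l.+1).

(* In the last four relations all composites vanish if l = 0, resp. h = 0.    *)
Inductive web_relation : term K -> term K -> Prop :=
| web_mergeA h k l :
    web_relation (wmerge (h + k) l ∘ (wmerge h k ⊗ \1_l))
                 (wmerge h (k + l) ∘ (\1_h ⊗ wmerge k l))
| web_splitA h k l :
    web_relation ((wsplit h k ⊗ \1_l) ∘ wsplit (h + k) l)
                 ((\1_h ⊗ wsplit k l) ∘ wsplit h (k + l))
| web_digon k l :
    web_relation (wmerge k l ∘ wsplit k l) ('C(k + l, l)%:R *: \1_(k + l)%N)
| web_dot2 k :
    web_relation (wdot k ∘ wdot k) (k%:R *: \1_k)
| web_dot_merge k l :
    web_relation (wdot (k + l) ∘ wmerge k l)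
                 (wmerge k l ∘ (wdot k ⊗ \1_l + \1_k ⊗ wdot l))
| web_split_dot k l :
    web_relation (wsplit k l ∘ wdot (k + l))
                 ((wdot k ⊗ \1_l + \1_k ⊗ wdot l) ∘ wsplit k l)
| web_dots_crossing :
    web_relation
      (wsplit 1 1 ∘ wmerge 1 1
         - (wdot 1 ⊗ wdot 1) ∘ wsplit 1 1 ∘ wmerge 1 1 ∘ (wdot 1 ⊗ wdot 1))
      (2%:R *: (\1_1 ⊗ \1_1))
| web_EF k l :
    web_relation (comp_EF webE webF k l - comp_FE webF webE k l)
                 ((k%:R - l%:R)%R *: (\1_k ⊗ \1_l))
| web_dEF k l :
    web_relation (comp_EF webdE webF k l - comp_FE webF webdE k l)
                 (wdot k ⊗ \1_l - \1_k ⊗ wdot l)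
| web_EdF k l :
    web_relation (comp_EF webE webdF k l - comp_FE webdF webE k l)
                 (wdot k ⊗ \1_l - \1_k ⊗ wdot l)
| web_EE h k l : (0 < l)%N ->
    web_relation (comp_E1E2 webE webE h k l - comp_E2E1 webE webE h k l)
                 (comp_E1E2 webdE webdE h k l + comp_E2E1 webdE webdE h k l)
| web_FF h k l : (0 < h)%N ->
    web_relation (comp_F2F1 webF webF h k l - comp_F1F2 webF webF h k l)
                 (comp_F1F2 webdF webdF h k l + comp_F2F1 webdF webdF h k l)
| web_EdE h k l : (0 < l)%N ->
    web_relation (comp_E1E2 webE webdE h k l - comp_E2E1 webdE webE h k l)
                 (comp_E1E2 webdE webE h k l - comp_E2E1 webE webdE h k l)
| web_FdF h k l : (0 < h)%N ->
    web_relation (comp_F1F2 webF webdF h k l - comp_F2F1 webdF webF h k l)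
                 (comp_F1F2 webdF webF h k l - comp_F2F1 webF webdF h k l).

(* The congruence presenting the category. Ill-formed expressions never       *)
(* interfere with well-formed ones, see [weq_typed].                          *)
Inductive weq : term K -> term K -> Prop :=
| weq_structural t u : parallel t u -> structural t u -> weq t u
| weq_relation t u : web_relation t u -> weq t u
| weq_refl t : weq t t
| weq_sym t u : weq t u -> weq u t
| weq_trans t u v : weq t u -> weq u v -> weq t v
| weq_cmp t t' u u' : weq t t' -> weq u u' -> weq (t ∘ u) (t' ∘ u')
| weq_tns t t' u u' : weq t t' -> weq u u' -> weq (t ⊗ u) (t' ⊗ u')
| weq_add t t' u u' : weq t t' -> weq u u' -> weq (t + u) (t' + u')
| weq_scl c t t' : weq t t' -> weq (c *: t) (c *: t').

Definition crossing : term K := wsplit 1 1 ∘ wmerge 1 1 - \1_1 ⊗ \1_1.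

Definition ones (n : nat) : wobj := ups (nseq n 1%N).

Fixpoint merges (k : nat) : term K :=
  if k is n.+1 then wmerge n 1 ∘ (merges n ⊗ \1_1) else Id [::].

Fixpoint splits (k : nat) : term K :=
  if k is n.+1 then (splits n ⊗ \1_1) ∘ wsplit n 1 else Id [::].

(* The crossing of the strands i and i+1 (counted from 0) among n.            *)
Definition crossing_at (n i : nat) : term K :=
  Id (ones i) ⊗ crossing ⊗ Id (ones (n - i - 2)).

(* A reduced word of the block permutation, first crossing first: the strands *)
(* k-1, ..., 0 are moved in turn past the l strands of the second block.      *)
Definition block_word (k l : nat) : seq nat :=
  [seq (i + j)%N | i <- rev (iota 0 k), j <- iota 0 l].

Definition block_crossing (k l : nat) : term K :=
  foldl (fun t i => crossing_at (k + l) i ∘ t) (Id (ones (k + l)))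
    (block_word k l).

Definition beta1 (k l : nat) : term K :=
  if ((0 < k) && (0 < l))%N then
    ((k`! * l`!)%N%:R)^-1 *:
      ((merges l ⊗ merges k) ∘ block_crossing k l ∘ (splits k ⊗ splits l))
  else \1_k ⊗ \1_l.

Fixpoint beta_strand (k : nat) (b : seq nat) : term K :=
  if b is l :: b' then
    (\1_l ⊗ beta_strand k b') ∘ (beta1 k l ⊗ Id (ups b'))
  else \1_k.

Fixpoint beta_tuple (a b : seq nat) : term K :=
  if a is k :: a' then
    (beta_strand k b ⊗ Id (ups a')) ∘ (\1_k ⊗ beta_tuple a' b)
  else Id (ups b).

End Presentation.

Section Typing.
Context {K : fieldType}.
Implicit Types t u : term K.
Local Open Scope web_scope.

Definition typed (a b : wobj) (t : term K) : bool :=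
  [&& wf t, src t == a & tgt t == b].

Lemma typedI t : wf t -> typed (src t) (tgt t) t.
Proof. by move=> w; rewrite /typed w !eqxx. Qed.

Lemma parallelP t u :
  reflect (exists a b, typed a b t /\ typed a b u) (parallel t u).
Proof.
apply: (iffP and4P) => [[wt wu /eqP s /eqP g]|].
  exists (src t), (tgt t); split; first exact: typedI.
  by rewrite s g typedI.
move=> [a [b [/and3P[wt /eqP <- /eqP <-] /and3P[wu /eqP -> /eqP ->]]]].
by rewrite wt wu.
Qed.

Lemma parallel_typed a b t u : typed a b t -> typed a b u -> parallel t u.
Proof. by move=> ht hu; apply/parallelP; exists a, b. Qed.

Lemma typed_cmp a b c t u : typed b c t -> typed a b u -> typed a c (t ∘ u).
Proof.
move=> /and3P[wt /eqP st /eqP tt] /and3P[wu /eqP su /eqP tu].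
by rewrite /typed /= wt wu st su tt tu !eqxx.
Qed.

Lemma typed_tns a b c d t u :
  typed a b t -> typed c d u -> typed (a ++ c) (b ++ d) (t ⊗ u).
Proof.
move=> /and3P[wt /eqP st /eqP tt] /and3P[wu /eqP su /eqP tu].
by rewrite /typed /= wt wu st su tt tu !eqxx.
Qed.

Lemma typed_add a b t u : typed a b t -> typed a b u -> typed a b (t + u).
Proof.
move=> /and3P[wt /eqP st /eqP tt] /and3P[wu /eqP su /eqP tu].
by rewrite /typed /= wt wu st su tt tu !eqxx.
Qed.

Lemma typed_scl a b c t : typed a b t -> typed a b (c *: t).
Proof. by []. Qed.

Lemma typed_id a : typed a a (Id a).
Proof. by rewrite /typed /= !eqxx. Qed.

Lemma typed_zero a b : typed a b (Zero a b).
Proof. by rewrite /typed /= !eqxx. Qed.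

Lemma typed_dot k : typed (up k) (up k) (wdot k).
Proof. by case: k => [|k]; rewrite /typed /= ?eqxx. Qed.

Lemma typed_merge k l : typed (up k ++ up l) (up (k + l)) (wmerge k l).
Proof.
case: k l => [|k] [|l]; rewrite /typed /= ?eqxx //.
by rewrite addn0 eqxx.
Qed.

Lemma typed_split k l : typed (up (k + l)) (up k ++ up l) (wsplit k l).
Proof.
case: k l => [|k] [|l]; rewrite /typed /= ?eqxx //.
by rewrite addn0 eqxx.
Qed.

Lemma typed_ladE j k l : (j <= l)%N ->
  typed (up k ++ up l) (up (k + j) ++ up (l - j)) (ladE j k l).
Proof.
move=> jl; apply: (@typed_cmp _ (up k ++ up j ++ up (l - j))).
  by rewrite catA; apply: typed_tns (typed_merge _ _) (typed_id _).
rewrite -{1}(subnKC jl).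
exact: typed_tns (typed_id _) (typed_split _ _).
Qed.

Lemma typed_ladF j k l : (j <= k)%N ->
  typed (up k ++ up l) (up (k - j) ++ up (j + l)) (ladF j k l).
Proof.
move=> jk; apply: (@typed_cmp _ (up (k - j) ++ up j ++ up l)).
  exact: typed_tns (typed_id _) (typed_merge _ _).
rewrite -{1}(subnK jk) catA.
exact: typed_tns (typed_split _ _) (typed_id _).
Qed.

Definition rtypeE (P : nat -> nat -> term K) := forall k l, (0 < l)%N ->
  typed (up k ++ up l) (up k.+1 ++ up l.-1) (P k l).
Definition rtypeF (P : nat -> nat -> term K) := forall k l, (0 < k)%N ->
  typed (up k ++ up l) (up k.-1 ++ up l.+1) (P k l).

Lemma typed_E : rtypeE webE.
Proof.
by move=> k [|l] // _; have := @typed_ladE 1 k l.+1 isT; rewrite addn1 subn1.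
Qed.

Lemma typed_F : rtypeF webF.
Proof.
by move=> [|k] l // _; have := @typed_ladF 1 k.+1 l isT; rewrite subn1.
Qed.

Lemma typed_dE : rtypeE webdE.
Proof.
move=> k [|l] // _; rewrite /webdE subn1 /=.
apply: (@typed_cmp _ (up k ++ up 1 ++ up l)); last first.
  exact: typed_tns (typed_id _) (typed_split 1 _).
apply: (@typed_cmp _ (up k ++ up 1 ++ up l)).
  have := typed_tns (typed_merge k 1) (typed_id (up l)).
  by rewrite addn1 -catA.
exact: typed_tns (typed_id _) (typed_tns (typed_dot 1) (typed_id _)).
Qed.

Lemma typed_dF : rtypeF webdF.
Proof.
move=> [|k] l // _; rewrite /webdF subn1 /=.
apply: (@typed_cmp _ (up k ++ up 1 ++ up l)); last first.
  have := typed_tns (typed_split k 1) (typed_id (up l)).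
  by rewrite addn1 -catA.
apply: (@typed_cmp _ (up k ++ up 1 ++ up l)).
  exact: typed_tns (typed_id _) (typed_merge 1 _).
exact: typed_tns (typed_id _) (typed_tns (typed_dot 1) (typed_id _)).
Qed.

Lemma typed_comp_EF P Q k l : rtypeE P -> rtypeF Q ->
  typed (up k ++ up l) (up k ++ up l) (comp_EF P Q k l).
Proof.
move=> hP hQ; rewrite /comp_EF; case: k => [|k]; first exact: typed_zero.
exact: typed_cmp (hP _ l.+1 _) (hQ k.+1 _ _).
Qed.

Lemma typed_comp_FE P Q k l : rtypeF P -> rtypeE Q ->
  typed (up k ++ up l) (up k ++ up l) (comp_FE P Q k l).
Proof.
move=> hP hQ; rewrite /comp_FE; case: l => [|l]; first exact: typed_zero.
exact: typed_cmp (hP k.+1 _ _) (hQ _ l.+1 _).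
Qed.

Lemma typed_E1E2 P Q h k l : rtypeE P -> rtypeE Q -> (0 < l)%N ->
  typed (up h ++ up k ++ up l) (up h.+1 ++ up k ++ up l.-1)
    (comp_E1E2 P Q h k l).
Proof.
move=> hP hQ l0; apply: (@typed_cmp _ (up h ++ up k.+1 ++ up l.-1)).
  by rewrite 2!catA; apply: typed_tns (hP _ k.+1 _) (typed_id _).
exact: typed_tns (typed_id _) (hQ _ _ _).
Qed.

Lemma typed_E2E1 P Q h k l : rtypeE P -> rtypeE Q -> (0 < l)%N ->
  typed (up h ++ up k ++ up l) (up h.+1 ++ up k ++ up l.-1)
    (comp_E2E1 P Q h k l).
Proof.
move=> hP hQ l0; rewrite /comp_E2E1.
case: k => [|k]; first exact: typed_zero.
apply: (@typed_cmp _ (up h.+1 ++ up k ++ up l)).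
  exact: typed_tns (typed_id _) (hP _ _ _).
by rewrite 2!catA; apply: typed_tns (hQ _ k.+1 _) (typed_id _).
Qed.

Lemma typed_F2F1 P Q h k l : rtypeF P -> rtypeF Q -> (0 < h)%N ->
  typed (up h ++ up k ++ up l) (up h.-1 ++ up k ++ up l.+1)
    (comp_F2F1 P Q h k l).
Proof.
move=> hP hQ h0; apply: (@typed_cmp _ (up h.-1 ++ up k.+1 ++ up l)).
  exact: typed_tns (typed_id _) (hP k.+1 _ _).
by rewrite 2!catA; apply: typed_tns (hQ _ _ _) (typed_id _).
Qed.

Lemma typed_F1F2 P Q h k l : rtypeF P -> rtypeF Q -> (0 < h)%N ->
  typed (up h ++ up k ++ up l) (up h.-1 ++ up k ++ up l.+1)
    (comp_F1F2 P Q h k l).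
Proof.
move=> hP hQ h0; rewrite /comp_F1F2.
case: k => [|k]; first exact: typed_zero.
apply: (@typed_cmp _ (up h ++ up k ++ up l.+1)).
  by rewrite 2!catA; apply: typed_tns (hP _ _ _) (typed_id _).
exact: typed_tns (typed_id _) (hQ k.+1 _ _).
Qed.

Lemma typed_sub a b t u : typed a b t -> typed a b u -> typed a b (t - u).
Proof. exact: typed_add. Qed.

Lemma web_relation_parallel t u : web_relation t u -> parallel t u.
Proof.
pose tT a b c d (t u : term K) := @typed_tns a b c d t u.
have tId := @typed_id; have tM := typed_merge; have tS := typed_split.
have tD := typed_dot.
have tDD k l : typed (up k ++ up l) (up k ++ up l)
    (wdot k ⊗ \1_l + \1_k ⊗ wdot l).
  by apply: typed_add; apply: typed_tns.
have tDDm k l : typed (up k ++ up l) (up k ++ up l)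
    (wdot k ⊗ \1_l - \1_k ⊗ wdot l).
  by apply: typed_sub; apply: typed_tns.
case=> [h k l|h k l|k l|k|k l|k l||k l|k l|k l|h k l l0|h k l h0|h k l l0|h k l h0].
- apply: (@parallel_typed (up h ++ up k ++ up l) (up (h + k + l))).
    by rewrite catA; apply: typed_cmp (tM _ _) (tT _ _ _ _ _ _ (tM _ _) (tId _)).
  by rewrite -addnA; apply: typed_cmp (tM _ _) (tT _ _ _ _ _ _ (tId _) (tM _ _)).
- apply: (@parallel_typed (up (h + k + l)) (up h ++ up k ++ up l)).
    by rewrite catA; apply: typed_cmp (tT _ _ _ _ _ _ (tS _ _) (tId _)) (tS _ _).
  by rewrite -addnA; apply: typed_cmp (tT _ _ _ _ _ _ (tId _) (tS _ _)) (tS _ _).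
- apply: (@parallel_typed (up (k + l)) (up (k + l))).
    exact: typed_cmp (tM _ _) (tS _ _).
  exact/typed_scl/tId.
- apply: (@parallel_typed (up k) (up k)); first exact: typed_cmp (tD _) (tD _).
  exact/typed_scl/tId.
- apply: (@parallel_typed (up k ++ up l) (up (k + l))).
    exact: typed_cmp (tD _) (tM _ _).
  exact: typed_cmp (tM _ _) (tDD _ _).
- apply: (@parallel_typed (up (k + l)) (up k ++ up l)).
    exact: typed_cmp (tS _ _) (tD _).
  exact: typed_cmp (tDD _ _) (tS _ _).
- by [].
- apply: (@parallel_typed (up k ++ up l) (up k ++ up l)).
    apply: typed_sub; first exact: typed_comp_EF typed_E typed_F.
    exact: typed_comp_FE typed_F typed_E.
  exact/typed_scl/typed_tns.
- apply: (@parallel_typed (up k ++ up l) (up k ++ up l)) => //.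
  apply: typed_sub; first exact: typed_comp_EF typed_dE typed_F.
  exact: typed_comp_FE typed_F typed_dE.
- apply: (@parallel_typed (up k ++ up l) (up k ++ up l)) => //.
  apply: typed_sub; first exact: typed_comp_EF typed_E typed_dF.
  exact: typed_comp_FE typed_dF typed_E.
- by apply: parallel_typed; apply: typed_add;
    (apply: typed_E1E2 || apply: typed_E2E1) => //; 
    (exact: typed_E || exact: typed_dE).
- by apply: parallel_typed; apply: typed_add;
    (apply: typed_F1F2 || apply: typed_F2F1) => //; 
    (exact: typed_F || exact: typed_dF).
- by apply: parallel_typed; apply: typed_add;
    (apply: typed_E1E2 || apply: typed_E2E1) => //; 
    (exact: typed_E || exact: typed_dE).
- by apply: parallel_typed; apply: typed_add;
    (apply: typed_F1F2 || apply: typed_F2F1) => //; 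
    (exact: typed_F || exact: typed_dF).
Qed.

Lemma weq_same t u : weq t u -> [/\ wf t = wf u, src t = src u & tgt t = tgt u].
Proof.
elim=> {t u}.
- by move=> t u /and4P[-> -> /eqP -> /eqP ->].
- by move=> t u /web_relation_parallel/and4P[-> -> /eqP -> /eqP ->].
- by [].
- by move=> t u _ [-> -> ->].
- by move=> t u v _ [-> -> ->] _ [-> -> ->].
- by move=> t t' u u' _ [wt st tt] _ [wu su tu]; rewrite /= wt wu st su tt tu.
- by move=> t t' u u' _ [wt st tt] _ [wu su tu]; rewrite /= wt wu st su tt tu.
- by move=> t t' u u' _ [wt st tt] _ [wu su tu]; rewrite /= wt wu st su tt tu.
- by move=> c t t' _ [wt st tt]; rewrite /= wt st tt.
Qed.

Lemma weq_typed a b t u : weq t u -> typed a b t = typed a b u.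
Proof. by rewrite /typed => /weq_same[-> -> ->]. Qed.

Lemma ones_cat m n : ones m ++ ones n = ones (m + n).
Proof. by rewrite /ones /ups -flatten_cat -map_cat -nseqD. Qed.

Lemma typed_crossing : typed (ones 2) (ones 2) crossing.
Proof. by []. Qed.

Lemma typed_merges k : typed (ones k) (up k) (merges k).
Proof.
elim: k => [|k IH] //.
have := typed_cmp (typed_merge k 1) (typed_tns IH (typed_id (ones 1))).
by rewrite ones_cat addn1.
Qed.

Lemma typed_splits k : typed (up k) (ones k) (splits k).
Proof.
elim: k => [|k IH] //.
have := typed_cmp (typed_tns IH (typed_id (ones 1))) (typed_split k 1).
by rewrite ones_cat addn1.
Qed.

Lemma typed_crossing_at n i : (i.+1 < n)%N ->
  typed (ones n) (ones n) (crossing_at n i).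
Proof.
move=> lt_in; have -> : ones n = ones i ++ ones 2 ++ ones (n - i - 2).
  by rewrite !ones_cat; congr ones; lia.
exact: typed_tns (typed_id _) (typed_tns typed_crossing (typed_id _)).
Qed.

Lemma typed_block_crossing k l :
  typed (ones (k + l)) (ones (k + l)) (block_crossing k l).
Proof.
rewrite /block_crossing; set n := (k + l)%N.
have hw : all (fun i => i.+1 < n)%N (block_word k l).
  apply/allP => p /allpairsP[[i j] [/= + + ->]].
  by rewrite mem_rev !mem_iota /n; lia.
move: (typed_id (ones n)); elim: (block_word k l) (Id _) hw => //= i w IH t.
by move=> /andP[hi hw] ht; apply/IH/typed_cmp/ht/typed_crossing_at.
Qed.

Lemma typed_beta1 k l : typed (up k ++ up l) (up l ++ up k) (beta1 k l).
Proof.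
rewrite /beta1; case: ifPn => [_|].
  apply/typed_scl/(@typed_cmp _ (ones k ++ ones l)); last first.
    by apply: typed_tns; apply: typed_splits.
  apply: (@typed_cmp _ (ones l ++ ones k)).
    by apply: typed_tns; apply: typed_merges.
  by rewrite !ones_cat (addnC l); apply: typed_block_crossing.
move=> h; suff -> : up l ++ up k = up k ++ up l.
  by apply: typed_tns; apply: typed_id.
by case: k l h => [|k] [|l].
Qed.

Lemma typed_beta_strand k b :
  typed (up k ++ ups b) (ups b ++ up k) (beta_strand k b).
Proof.
elim: b => [|l b IH] /=; first by rewrite cats0 typed_id.
apply: (@typed_cmp _ (up l ++ up k ++ ups b)).
  by rewrite -catA; apply: typed_tns (typed_id _) IH.
by rewrite [X in typed X]catA [X in typed _ X]catA; apply: typed_tns (typed_beta1 _ _) (typed_id _).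
Qed.

Lemma typed_beta a b : typed (ups a ++ ups b) (ups b ++ ups a) (beta_tuple a b).
Proof.
elim: a => [|k a IH] /=; first by rewrite cats0 typed_id.
apply: (@typed_cmp _ (up k ++ ups b ++ ups a)).
  by rewrite [X in typed X]catA [X in typed _ X]catA;
     apply: typed_tns (typed_beta_strand _ _) (typed_id _).
by rewrite -catA; apply: typed_tns (typed_id _) IH.
Qed.

End Typing.

HB.instance Definition _ (K : Type) := gen_eqMixin (term K).
HB.instance Definition _ (K : Type) := gen_choiceMixin (term K).

Section Hom.
Context {K : fieldType} (a b : wobj).
Local Open Scope web_scope.

Definition wterm := {t : term K | typed a b t}.

Definition wequ : rel wterm := fun t u => `[< weq (val t) (val u) >].

Lemma wequ_equiv : equiv_class_of wequ.
Proof.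
split=> [t|t u|u t v].
- exact/asboolP/weq_refl.
- by apply/asboolP/asboolP; apply: weq_sym.
- by move=> /asboolP tu /asboolP uv; apply/asboolP/(weq_trans tu uv).
Qed.
Canonical wequ_equiv_rel := EquivRelPack wequ_equiv.

Definition whom := {eq_quot wequ}.
HB.instance Definition _ := Choice.on whom.

Definition wclass (t : term K) (h : typed a b t) : whom :=
  \pi_({eq_quot wequ}) (exist _ t h).

Lemma wclassP t u (ht : typed a b t) (hu : typed a b u) :
  wclass ht = wclass hu <-> weq t u.
Proof.
split=> [/eqmodP/asboolP //|h].
by apply/eqmodP/asboolP.
Qed.

Definition wrepr (f : whom) : term K := val (repr (f : {eq_quot wequ})).

Lemma typed_wrepr f : typed a b (wrepr f).
Proof. exact: valP. Qed.

Lemma wreprK f : wclass (typed_wrepr f) = f.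
Proof.
rewrite -[RHS](reprK (f : {eq_quot wequ})) /wclass; congr (\pi_ _ _).
exact: val_inj.
Qed.

Lemma whomP (f : whom) : exists t (ht : typed a b t), f = wclass ht.
Proof. by exists (wrepr f), (typed_wrepr f); rewrite wreprK. Qed.

Lemma wrepr_class t (h : typed a b t) : weq (wrepr (wclass h)) t.
Proof. by apply/(wclassP (typed_wrepr _) h); rewrite wreprK. Qed.

Definition whom_zero : whom := wclass (typed_zero a b).
Definition whom_add (f g : whom) : whom :=
  wclass (typed_add (typed_wrepr f) (typed_wrepr g)).
Definition whom_scl (c : K) (f : whom) : whom :=
  wclass (typed_scl c (typed_wrepr f)).
Definition whom_opp (f : whom) : whom := whom_scl (-1) f.

Lemma whom_addE t u (ht : typed a b t) (hu : typed a b u) :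
  whom_add (wclass ht) (wclass hu) = wclass (typed_add ht hu).
Proof. by apply/wclassP/weq_add; apply: wrepr_class. Qed.

Lemma whom_sclE c t (ht : typed a b t) :
  whom_scl c (wclass ht) = wclass (typed_scl c ht).
Proof. by apply/wclassP/weq_scl/wrepr_class. Qed.

Lemma wclass_eq t u (ht : typed a b t) (hu : typed a b u) :
  structural t u -> wclass ht = wclass hu.
Proof.
by move=> h; apply/wclassP/weq_structural => //; apply: parallel_typed hu.
Qed.

Fact whom_addA : associative whom_add.
Proof.
move=> f g h; have [t [ht ->]] := whomP f; have [u [hu ->]] := whomP g.
have [v [hv ->]] := whomP h; rewrite !whom_addE.
exact/wclass_eq/st_addA.
Qed.

Fact whom_addC : commutative whom_add.
Proof.
move=> f g; have [t [ht ->]] := whomP f; have [u [hu ->]] := whomP g.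
by rewrite !whom_addE; apply/wclass_eq/st_addC.
Qed.

Fact whom_add0 : left_id whom_zero whom_add.
Proof.
move=> f; have [t [ht ->]] := whomP f; rewrite whom_addE.
apply/wclass_eq; case/and3P: (ht) => _ /eqP <- /eqP <-.
exact: st_add0.
Qed.

Fact whom_addN : left_inverse whom_zero whom_opp whom_add.
Proof.
move=> f; rewrite whom_addC /whom_opp.
have [t [ht ->]] := whomP f; rewrite whom_sclE whom_addE.
apply/wclass_eq; case/and3P: (ht) => _ /eqP <- /eqP <-.
exact: st_addN.
Qed.

HB.instance Definition _ :=
  GRing.isZmodule.Build whom whom_addA whom_addC whom_add0 whom_addN.

Fact whom_sclA c d (f : whom) : whom_scl c (whom_scl d f) = whom_scl (c * d) f.
Proof.
have [t [ht ->]] := whomP f; rewrite !whom_sclE.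
exact/wclass_eq/st_sclA.
Qed.

Fact whom_scl1 : left_id 1 whom_scl.
Proof.
move=> f; have [t [ht ->]] := whomP f; rewrite !whom_sclE.
exact/wclass_eq/st_scl1.
Qed.

Fact whom_sclDr : right_distributive whom_scl +%R.
Proof.
move=> c f g; have [t [ht ->]] := whomP f; have [u [hu ->]] := whomP g.
rewrite -[LHS]/(whom_scl c (whom_add _ _)).
rewrite -[RHS]/(whom_add (whom_scl _ _) (whom_scl _ _)).
rewrite !(whom_sclE, whom_addE).
exact/wclass_eq/st_sclDr.
Qed.

Fact whom_sclDl (f : whom) :
  {morph whom_scl^~ f : c d / (c + d)%R >-> (c + d)%R}.
Proof.
move=> c d; have [t [ht ->]] := whomP f.
rewrite -[RHS]/(whom_add (whom_scl _ _) (whom_scl _ _)).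
rewrite !(whom_sclE, whom_addE).
exact/wclass_eq/st_sclDl.
Qed.

HB.instance Definition _ := GRing.Zmodule_isLmodule.Build K whom
  whom_sclA whom_scl1 whom_sclDr whom_sclDl.

Lemma wclassD t u (ht : typed a b t) (hu : typed a b u) :
  (wclass ht + wclass hu)%R = wclass (typed_add ht hu).
Proof. exact: whom_addE. Qed.

Lemma wclassZ c t (ht : typed a b t) :
  (c *: wclass ht)%R = wclass (typed_scl c ht).
Proof. exact: whom_sclE. Qed.

Definition whom_homog (p : bool) : set whom :=
  [set f | exists t (ht : typed a b t), has_parity t p /\ f = wclass ht].

End Hom.

Arguments whom K : clear implicits.

Section Parity.
Context {K : numFieldType}.
Implicit Types t u : term K.
Local Open Scope web_scope.

Fixpoint parity_twist t : term K :=
  match t with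
  | Dot k => (-1) *: Dot k
  | Cmp f g => parity_twist f ∘ parity_twist g
  | Tns f g => parity_twist f ⊗ parity_twist g
  | Add f g => parity_twist f + parity_twist g
  | Scl c f => c *: parity_twist f
  | _ => t
  end.

Lemma src_twist t : src (parity_twist t) = src t.
Proof. by elim: t => //= f -> g ->. Qed.

Lemma tgt_twist t : tgt (parity_twist t) = tgt t.
Proof. by elim: t => //= f -> g ->. Qed.

Lemma wf_twist t : wf (parity_twist t) = wf t.
Proof.
by elim: t => //= f -> g ->; rewrite ?src_twist ?tgt_twist.
Qed.

Lemma has_parity_twist t p : has_parity (parity_twist t) p = has_parity t p.
Proof. by elim: t p => //= f IHf g IHg p; rewrite !(IHf, IHg). Qed.

Lemma parallel_twist t u :
  parallel (parity_twist t) (parity_twist u) = parallel t u.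
Proof. by rewrite /parallel !wf_twist !src_twist !tgt_twist. Qed.

Lemma structural_twist t u :
  structural t u -> structural (parity_twist t) (parity_twist u).
Proof.
case=> *; rewrite /=; try by constructor.
- by rewrite -tgt_twist; apply: st_comp1l.
- by rewrite -src_twist; apply: st_comp1r.
- by apply: st_interchange; rewrite has_parity_twist.
- by rewrite -src_twist -tgt_twist; apply: st_add0.
- by rewrite -src_twist -tgt_twist; apply: st_addN.
Qed.

Lemma weq_scl_scl c d t : wf t -> weq (c *: (d *: t)) ((c * d)%R *: t).
Proof.
move=> wt; apply: weq_structural (st_sclA _ _ _).
by rewrite /parallel /= wt !eqxx.
Qed.

Lemma weq_bilin_cmp c d t u : wf (t ∘ u) ->
  weq ((c *: t) ∘ (d *: u)) ((c * d)%R *: (t ∘ u)).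
Proof.
move=> /= h; apply: weq_trans (weq_scl_scl _ _ _) => //.
have h1 : parallel ((c *: t) ∘ (d *: u)) (c *: (t ∘ (d *: u))).
  by rewrite /parallel /= h !eqxx.
apply: weq_trans (weq_structural h1 (st_compZl _ _ _)) _.
apply/weq_scl/weq_structural/st_compZr.
by rewrite /parallel /= h !eqxx.
Qed.

Lemma weq_bilin_tns c d t u : wf (t ⊗ u) ->
  weq ((c *: t) ⊗ (d *: u)) ((c * d)%R *: (t ⊗ u)).
Proof.
move=> /= h; apply: weq_trans (weq_scl_scl _ _ _) => //.
have h1 : parallel ((c *: t) ⊗ (d *: u)) (c *: (t ⊗ (d *: u))).
  by rewrite /parallel /= h !eqxx.
apply: weq_trans (weq_structural h1 (st_tensZl _ _ _)) _.
apply/weq_scl/weq_structural/st_tensZr.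
by rewrite /parallel /= h !eqxx.
Qed.

Lemma weq_scl1 t : wf t -> weq t (1 *: t).
Proof.
move=> wt; apply/weq_sym/weq_structural/st_scl1.
by rewrite /parallel /= wt !eqxx.
Qed.

Lemma weq_scl_zero c x y : weq (Zero x y) ((c : K) *: Zero x y).
Proof.
have e : (c *: wclass (typed_zero x y))%R = wclass (typed_zero x y) :> whom K x y.
  exact: scaler0.
by apply/weq_sym; rewrite wclassZ in e; move/wclassP: e.
Qed.

Lemma weq_twist_parity t p : wf t -> has_parity t p ->
  weq (parity_twist t) ((-1) ^+ p *: t).
Proof.
elim: t p => /= [x|k|k l|k l|f IHf g IHg|f IHf g IHg|x y|f IHf g IHg|c f IHf] p.
- by case: p => // _ _; apply: weq_scl1.
- by case: p => //= _ _; apply: weq_refl.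
- by case: p => // w _; apply: weq_scl1.
- by case: p => // w _; apply: weq_scl1.
- move=> w; have /and3P[wf_f wf_g _] := w.
  case/orP=> /andP[pf pg].
    apply: weq_trans (weq_cmp (IHf _ wf_f pf) (IHg _ wf_g pg)) _.
    by have := weq_bilin_cmp ((-1) ^+ false) ((-1) ^+ p) w; rewrite -signr_addb.
  apply: weq_trans (weq_cmp (IHf _ wf_f pf) (IHg _ wf_g pg)) _.
  have := weq_bilin_cmp ((-1) ^+ true) ((-1) ^+ ~~ p) w.
  by rewrite -signr_addb addTb negbK.
- move=> w; have /andP[wf_f wf_g] := w.
  case/orP=> /andP[pf pg].
    apply: weq_trans (weq_tns (IHf _ wf_f pf) (IHg _ wf_g pg)) _.
    by have := weq_bilin_tns ((-1) ^+ false) ((-1) ^+ p) w; rewrite -signr_addb.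
  apply: weq_trans (weq_tns (IHf _ wf_f pf) (IHg _ wf_g pg)) _.
  have := weq_bilin_tns ((-1) ^+ true) ((-1) ^+ ~~ p) w.
  by rewrite -signr_addb addTb negbK.
- by move=> _ _; apply: weq_scl_zero.
- move=> w; have /and4P[wf_f wf_g _ _] := w; case/andP=> pf pg.
  apply: weq_trans (weq_add (IHf _ wf_f pf) (IHg _ wf_g pg)) _.
  apply/weq_sym/weq_structural/st_sclDr.
  by rewrite /parallel /= w !eqxx.
- move=> w pf; apply: weq_trans (weq_scl _ (IHf _ w pf)) _.
  apply: weq_trans (weq_scl_scl _ _ w) _; rewrite mulrC.
  exact/weq_sym/weq_scl_scl.
Qed.

Lemma has_parity_cmp t u p q : has_parity t p -> has_parity u q ->
  has_parity (t ∘ u) (p (+) q).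
Proof. by case: p; case: q => /= -> -> //; rewrite orbT. Qed.

Lemma has_parity_tns t u p q : has_parity t p -> has_parity u q ->
  has_parity (t ⊗ u) (p (+) q).
Proof. exact: has_parity_cmp. Qed.

Lemma even_merge k l : has_parity (wmerge k l : term K) false.
Proof. by rewrite /wmerge; case: ifP. Qed.

Lemma even_split k l : has_parity (wsplit k l : term K) false.
Proof. by rewrite /wsplit; case: ifP. Qed.

Lemma odd_dot k : has_parity (wdot k : term K) true.
Proof. by rewrite /wdot; case: ifP. Qed.

Lemma even_E k l : has_parity (webE k l : term K) false.
Proof. by rewrite /webE /ladE /= !even_merge /= !even_split /=. Qed.

Lemma even_F k l : has_parity (webF k l : term K) false.
Proof. by rewrite /webF /ladF /= !even_merge /= !even_split /=. Qed.

Lemma odd_dE k l : has_parity (webdE k l : term K) true.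
Proof.
rewrite /webdE; set m := wmerge _ _; set s := wsplit _ _; set d := _ ⊗ wdot 1 ⊗ _.
have hd : has_parity d true by [].
have hm x y : has_parity (m ⊗ Id x) false && has_parity (Id y ⊗ m) false.
  by rewrite /= even_merge.
have hs x y : has_parity (s ⊗ Id x) false && has_parity (Id y ⊗ s) false.
  by rewrite /= even_split.
apply: (@has_parity_cmp _ _ true false); last by case/andP: (hs (up (l - 1)) (up k)).
by apply: (@has_parity_cmp _ _ false true) => //; case/andP: (hm (up (l - 1)) (up k)).
Qed.

Lemma odd_dF k l : has_parity (webdF k l : term K) true.
Proof.
rewrite /webdF; set m := wmerge _ _; set s := wsplit _ _; set d := _ ⊗ wdot 1 ⊗ _.
have hd : has_parity d true by [].
have hm x y : has_parity (m ⊗ Id x) false && has_parity (Id y ⊗ m) false.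
  by rewrite /= even_merge.
have hs x y : has_parity (s ⊗ Id x) false && has_parity (Id y ⊗ s) false.
  by rewrite /= even_split.
apply: (@has_parity_cmp _ _ true false); last by case/andP: (hs (up l) [::]).
by apply: (@has_parity_cmp _ _ false true) => //; case/andP: (hm [::] (up (k - 1))).
Qed.

Lemma parity_zero a b p : has_parity (Zero a b : term K) p.
Proof. by []. Qed.

Lemma parity_id a : has_parity (Id a : term K) false.
Proof. by []. Qed.

Definition all_parity (P : nat -> nat -> term K) p := forall k l,
  has_parity (P k l) p.

Lemma parity_comp P Q p q : all_parity P p -> all_parity Q q ->
  [/\ forall k l, has_parity (comp_EF P Q k l) (p (+) q),
      forall k l, has_parity (comp_FE P Q k l) (p (+) q) &
      forall h k l,
      [/\ has_parity (comp_E1E2 P Q h k l) (p (+) q),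
          has_parity (comp_E2E1 P Q h k l) (p (+) q),
          has_parity (comp_F1F2 P Q h k l) (p (+) q) &
          has_parity (comp_F2F1 P Q h k l) (p (+) q)]].
Proof.
move=> hP hQ.
have tl r (x : term K) a : has_parity x r -> has_parity (x ⊗ Id a) r.
  by move=> h; rewrite -[r]addbF; apply: has_parity_tns.
have tr r (x : term K) a : has_parity x r -> has_parity (Id a ⊗ x) r.
  by move=> h; rewrite -[r]addFb; apply: has_parity_tns.
split=> *; last split;
  rewrite /comp_EF /comp_FE /comp_E2E1 /comp_F1F2; try case: ifP => _;
  try exact: parity_zero; apply: has_parity_cmp => //;
  by [apply: tl | apply: tr].
Qed.

Lemma web_relation_parity t u : web_relation t u ->
  exists p, has_parity t p && has_parity u p.
Proof.
have hm := even_merge; have hs := even_split; have hd := odd_dot.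
have add r (x y : term K) : has_parity x r -> has_parity y r -> has_parity (x + y) r.
  by rewrite /= => -> ->.
have scl r c (x : term K) : has_parity x r -> has_parity (c *: x) r by [].
have hdd k l : has_parity (wdot k ⊗ \1_l - \1_k ⊗ wdot l : term K) true.
  by apply: add; last apply: scl;
    [apply: (@has_parity_tns _ _ true false) | apply: (@has_parity_tns _ _ false true)].
have [ef1 fe1 c1] := parity_comp even_E even_F.
have [ef2 fe2 c2] := parity_comp even_F even_E.
have [ef3 fe3 _] := parity_comp odd_dE even_F.
have [ef4 fe4 _] := parity_comp even_F odd_dE.
have [ef5 fe5 _] := parity_comp even_E odd_dF.
have [ef6 fe6 _] := parity_comp odd_dF even_E.
have [_ _ c7] := parity_comp even_E even_E.
have [_ _ c8] := parity_comp odd_dE odd_dE.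
have [_ _ c9] := parity_comp even_E odd_dE.
have [_ _ c10] := parity_comp odd_dE even_E.
have [_ _ c11] := parity_comp even_F even_F.
have [_ _ c12] := parity_comp odd_dF odd_dF.
have [_ _ c13] := parity_comp even_F odd_dF.
have [_ _ c14] := parity_comp odd_dF even_F.
case=> [h k l|h k l|k l|k|k l|k l||k l|k l|k l|h k l l0|h k l h0|h k l l0|h k l h0].
- by exists false; rewrite /= !hm.
- by exists false; rewrite /= !hs.
- by exists false; rewrite /= hm hs.
- by exists false; rewrite /= !hd orbT.
- by exists true; rewrite /= !hm !hd !orbT.
- by exists true; rewrite /= !hs !hd !orbT.
- by exists false.
- by exists false; apply/andP; split=> //; apply: add; last apply: scl.
- exists true; apply/andP; split; last exact: hdd.
  by apply: add; [apply: ef3 | apply: scl; apply: fe4].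
- exists true; apply/andP; split; last exact: hdd.
  by apply: add; [apply: ef5 | apply: scl; apply: fe6].
- have [? ? _ _] := c7 h k l; have [? ? _ _] := c8 h k l.
  by exists false; apply/andP; split; apply: add => //; apply: scl.
- have [_ _ ? ?] := c11 h k l; have [_ _ ? ?] := c12 h k l.
  by exists false; apply/andP; split; apply: add => //; apply: scl.
- have [? ? _ _] := c9 h k l; have [? ? _ _] := c10 h k l.
  by exists true; apply/andP; split; apply: add => //; apply: scl.
- have [_ _ ? ?] := c13 h k l; have [_ _ ? ?] := c14 h k l.
  by exists true; apply/andP; split; apply: add => //; apply: scl.
Qed.

Lemma weq_twist t u : weq t u -> weq (parity_twist t) (parity_twist u).
Proof.
elim=> {t u}.
- move=> t u tu /structural_twist; apply: weq_structural.
  by rewrite parallel_twist.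
- move=> t u tu; have [p /andP[pt pu]] := web_relation_parity tu.
  have /and4P[wt wu _ _] := web_relation_parallel tu.
  apply: weq_trans (weq_twist_parity wt pt) _.
  apply: weq_trans (weq_sym (weq_twist_parity wu pu)).
  exact/weq_scl/weq_relation.
- by move=> t; apply: weq_refl.
- by move=> t u _; apply: weq_sym.
- by move=> t u v _ + _; apply: weq_trans.
- by move=> t t' u u' _ + _; apply: weq_cmp.
- by move=> t t' u u' _ + _; apply: weq_tns.
- by move=> t t' u u' _ + _; apply: weq_add.
- by move=> c t t' _; apply: weq_scl.
Qed.

Context (a b : wobj).
Implicit Types f : whom K a b.

Lemma whom_homog0 p : whom_homog p (0 : whom K a b).
Proof. by exists (Zero a b), (typed_zero a b). Qed.

Lemma whom_homog_lin p c f g :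
  whom_homog p f -> whom_homog p g -> whom_homog p (c *: f + g)%R.
Proof.
move=> [t [ht [pt ->]]] [u [hu [pu ->]]].
exists (c *: t + u), (typed_add (typed_scl c ht) hu).
by rewrite /= pt pu wclassZ wclassD.
Qed.

Lemma whom_homog_cap f : whom_homog false f -> whom_homog true f -> f = 0%R.
Proof.
move=> [t [ht [pt ef]]] [u [hu [pu eg]]].
have tu : weq t u by apply/(wclassP ht hu); rewrite -ef.
have /and3P[wt _ _] := ht; have /and3P[wu _ _] := hu.
have tNu : weq (1 *: t) ((-1) *: u).
  apply: weq_trans (weq_sym (weq_twist_parity wt pt)) _.
  exact: weq_trans (weq_twist tu) (weq_twist_parity wu pu).
have {}tNu : (1 *: f = (-1) *: f)%R.
  rewrite {1}ef eg !wclassZ; exact/wclassP.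
have : (2%:R *: f == 0)%R.
  by rewrite scaler_nat mulr2n -[X in (X + _)%R]scale1r tNu scaleN1r addNr.
by rewrite scaler_eq0 pnatr_eq0 /= => /eqP.
Qed.

End Parity.

Section Operations.
Context {K : numFieldType}.
Local Open Scope web_scope.

Definition whom_id (a : wobj) : whom K a a := wclass (typed_id a).

Definition whom_comp a b c (f : whom K b c) (g : whom K a b) : whom K a c :=
  wclass (typed_cmp (typed_wrepr f) (typed_wrepr g)).

Definition whom_tens a b c d (f : whom K a b) (g : whom K c d) :
    whom K (a ++ c) (b ++ d) :=
  wclass (typed_tns (typed_wrepr f) (typed_wrepr g)).

Lemma whom_compE a b c t u (ht : typed b c t) (hu : typed a b u) :
  whom_comp (wclass ht) (wclass hu) = wclass (typed_cmp ht hu).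
Proof. by apply/wclassP/weq_cmp; apply: wrepr_class. Qed.

Lemma whom_tensE a b c d t u (ht : typed a b t) (hu : typed c d u) :
  whom_tens (wclass ht) (wclass hu) = wclass (typed_tns ht hu).
Proof. by apply/wclassP/weq_tns; apply: wrepr_class. Qed.

Let wE := (@whom_compE, @whom_tensE, @wclassZ K, @wclassD K).

Lemma whom_comp_parity a b c p q (f : whom K b c) (g : whom K a b) :
  whom_homog p f -> whom_homog q g -> whom_homog (p (+) q) (whom_comp f g).
Proof.
move=> [t [ht [pt ->]]] [u [hu [pu ->]]]; rewrite whom_compE.
by exists (t ∘ u), (typed_cmp ht hu); split=> //; apply: has_parity_cmp.
Qed.

Lemma whom_tens_parity a b c d p q (f : whom K a b) (g : whom K c d) :
  whom_homog p f -> whom_homog q g -> whom_homog (p (+) q) (whom_tens f g).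
Proof.
move=> [t [ht [pt ->]]] [u [hu [pu ->]]]; rewrite whom_tensE.
by exists (t ⊗ u), (typed_tns ht hu); split=> //; apply: has_parity_tns.
Qed.

Lemma whom_comp_linl a b c (g : whom K a b) :
  linear (fun f : whom K b c => whom_comp f g).
Proof.
move=> x f f'; have [t [ht ->]] := whomP f; have [u [hu ->]] := whomP f'.
have [v [hv ->]] := whomP g; rewrite [(x *: wclass _)%R]wclassZ wclassD !wE.
apply: etrans (wclass_eq _ (typed_add (typed_cmp (typed_scl x ht) hv) (typed_cmp hu hv))
  (st_compDl _ _ _)) _; rewrite -!wclassD; congr (_ + _)%R.
exact/wclass_eq/st_compZl.
Qed.

Lemma whom_comp_linr a b c (f : whom K b c) :
  linear (fun g : whom K a b => whom_comp f g).
Proof.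
move=> x g g'; have [t [ht ->]] := whomP g; have [u [hu ->]] := whomP g'.
have [v [hv ->]] := whomP f; rewrite [(x *: wclass _)%R]wclassZ wclassD !wE.
apply: etrans (wclass_eq _ (typed_add (typed_cmp hv (typed_scl x ht)) (typed_cmp hv hu))
  (st_compDr _ _ _)) _; rewrite -!wclassD; congr (_ + _)%R.
exact/wclass_eq/st_compZr.
Qed.

Lemma whom_tens_linl a b c d (g : whom K c d) :
  linear (fun f : whom K a b => whom_tens f g).
Proof.
move=> x f f'; have [t [ht ->]] := whomP f; have [u [hu ->]] := whomP f'.
have [v [hv ->]] := whomP g; rewrite [(x *: wclass _)%R]wclassZ wclassD !wE.
apply: etrans (wclass_eq _ (typed_add (typed_tns (typed_scl x ht) hv) (typed_tns hu hv))
  (st_tensDl _ _ _)) _; rewrite -!wclassD; congr (_ + _)%R.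
exact/wclass_eq/st_tensZl.
Qed.

Lemma whom_tens_linr a b c d (f : whom K a b) :
  linear (fun g : whom K c d => whom_tens f g).
Proof.
move=> x g g'; have [t [ht ->]] := whomP g; have [u [hu ->]] := whomP g'.
have [v [hv ->]] := whomP f; rewrite [(x *: wclass _)%R]wclassZ wclassD !wE.
apply: etrans (wclass_eq _ (typed_add (typed_tns hv (typed_scl x ht)) (typed_tns hv hu))
  (st_tensDr _ _ _)) _; rewrite -!wclassD; congr (_ + _)%R.
exact/wclass_eq/st_tensZr.
Qed.

Lemma whom_compA a b c d (f : whom K c d) (g : whom K b c) (h : whom K a b) :
  whom_comp f (whom_comp g h) = whom_comp (whom_comp f g) h.
Proof.
have [t [ht ->]] := whomP f; have [u [hu ->]] := whomP g.
have [v [hv ->]] := whomP h; rewrite !wE.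
exact/wclass_eq/st_compA.
Qed.

Lemma whom_comp1l a b (f : whom K a b) : whom_comp (whom_id b) f = f.
Proof.
have [t [ht ->]] := whomP f; rewrite /whom_id wE; apply: wclass_eq.
by case/and3P: ht => _ _ /eqP <-; apply: st_comp1l.
Qed.

Lemma whom_comp1r a b (f : whom K a b) : whom_comp f (whom_id a) = f.
Proof.
have [t [ht ->]] := whomP f; rewrite /whom_id wE; apply: wclass_eq.
by case/and3P: ht => _ /eqP <- _; apply: st_comp1r.
Qed.

Lemma whom_homog_dec a b (f : whom K a b) : exists f0 f1,
  [/\ whom_homog false f0, whom_homog true f1 & f = (f0 + f1)%R].
Proof.
have [t [ht ->]] := whomP f => {f}.
pose dec (t : term K) := forall a b (ht : typed a b t), exists f0 f1,
  [/\ whom_homog false f0, whom_homog true f1 & wclass ht = (f0 + f1)%R].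
have dec_homog (t' : term K) p : has_parity t' p -> dec t'.
  move=> pt a' b' ht'; case: p pt => pt.
    exists 0%R, (wclass ht'); split; rewrite ?add0r //; first exact: whom_homog0.
    by exists t', ht'.
  exists (wclass ht'), 0%R; split; rewrite ?addr0 //; last exact: whom_homog0.
  by exists t', ht'.
suff: dec t by [].
have homogD p x y (g h : whom K x y) :
    whom_homog p g -> whom_homog p h -> whom_homog p (g + h)%R.
  by rewrite -[g in (g + h)%R]scale1r; apply: whom_homog_lin.
elim: t {a b ht} => [x|k|k l|k l|f IHf g IHg|f IHf g IHg|x y|f IHf g IHg|c f IHf].
- exact: (dec_homog _ false).
- exact: (dec_homog _ true).
- exact: (dec_homog _ false).
- exact: (dec_homog _ false).
- move=> a b ht.
  have [/and3P[wf_f wf_g /eqP e] /eqP sg /eqP tf] := and3P ht.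
  have hf : typed (src f) b f by rewrite -tf; apply: typedI.
  have hg : typed a (src f) g by rewrite -sg e; apply: typedI.
  rewrite (_ : wclass ht = whom_comp (wclass hf) (wclass hg)); last first.
    by rewrite wE; apply/wclassP/weq_refl.
  have [f0 [f1 [pf0 pf1 ->]]] := IHf _ _ hf.
  have [g0 [g1 [pg0 pg1 ->]]] := IHg _ _ hg.
  exists (whom_comp f0 g0 + whom_comp f1 g1)%R,
    (whom_comp f0 g1 + whom_comp f1 g0)%R; split.
  + apply: homogD; first exact: (whom_comp_parity pf0 pg0).
    exact: (whom_comp_parity pf1 pg1).
  + apply: homogD; first exact: (whom_comp_parity pf0 pg1).
    exact: (whom_comp_parity pf1 pg0).
  + have := whom_comp_linl (g0 + g1)%R 1%R f0 f1; rewrite !scale1r => ->.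
    have := whom_comp_linr f0 1%R g0 g1; rewrite !scale1r => ->.
    have := whom_comp_linr f1 1%R g0 g1; rewrite !scale1r => ->.
    by rewrite [X in (_ + X)%R = _]addrC addrACA.
- move=> a b ht.
  have [/andP[wf_f wf_g] /eqP sfg /eqP tfg] := and3P ht.
  have hf : typed (src f) (tgt f) f by exact: typedI.
  have hg : typed (src g) (tgt g) g by exact: typedI.
  move: ht; rewrite -sfg -tfg => ht {sfg tfg}.
  rewrite (_ : wclass ht = whom_tens (wclass hf) (wclass hg)); last first.
    by rewrite wE; apply/wclassP/weq_refl.
  have [f0 [f1 [pf0 pf1 ->]]] := IHf _ _ hf.
  have [g0 [g1 [pg0 pg1 ->]]] := IHg _ _ hg.
  exists (whom_tens f0 g0 + whom_tens f1 g1)%R,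
    (whom_tens f0 g1 + whom_tens f1 g0)%R; split.
  + apply: homogD; first exact: (whom_tens_parity pf0 pg0).
    exact: (whom_tens_parity pf1 pg1).
  + apply: homogD; first exact: (whom_tens_parity pf0 pg1).
    exact: (whom_tens_parity pf1 pg0).
  + have := whom_tens_linl (g0 + g1)%R 1%R f0 f1; rewrite !scale1r => ->.
    have := whom_tens_linr f0 1%R g0 g1; rewrite !scale1r => ->.
    have := whom_tens_linr f1 1%R g0 g1; rewrite !scale1r => ->.
    by rewrite [X in (_ + X)%R = _]addrC addrACA.
- exact: (dec_homog _ false).
- move=> a b ht.
  have [/and4P[wf_f wf_g /eqP es /eqP et] /eqP sf /eqP tf] := and3P ht.
  have hf : typed a b f by rewrite -sf -tf; apply: typedI.
  have hg : typed a b g by rewrite -sf -tf /= es et; apply: typedI.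
  rewrite (_ : wclass ht = (wclass hf + wclass hg)%R); last first.
    by rewrite wE; apply/wclassP/weq_refl.
  have [f0 [f1 [pf0 pf1 ->]]] := IHf _ _ hf.
  have [g0 [g1 [pg0 pg1 ->]]] := IHg _ _ hg.
  exists (f0 + g0)%R, (f1 + g1)%R; split; try exact: homogD.
  by rewrite addrACA.
- move=> a b ht; have hf : typed a b f := ht.
  rewrite (_ : wclass ht = (c *: wclass hf)%R); last first.
    by rewrite wE; apply/wclassP/weq_refl.
  have [f0 [f1 [pf0 pf1 ->]]] := IHf _ _ hf.
  exists (c *: f0)%R, (c *: f1)%R; rewrite scalerDr; split=> //.
    by rewrite -[(c *: f0)%R]addr0; apply: whom_homog_lin => //; apply: whom_homog0.
  by rewrite -[(c *: f1)%R]addr0; apply: whom_homog_lin => //; apply: whom_homog0.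
Qed.

Lemma whom_id_even a : whom_homog false (whom_id a).
Proof. by exists (Id a), (typed_id a). Qed.

Lemma whom_tens_id a b : whom_tens (whom_id a) (whom_id b) = whom_id (a ++ b).
Proof. by rewrite whom_tensE; apply/wclass_eq/st_tens_id. Qed.

Lemma whom_interchange a b c a' b' c' p q (f : whom K b c)
    (g : whom K b' c') (h : whom K a b) (k : whom K a' b') :
  whom_homog p g -> whom_homog q h ->
  whom_comp (whom_tens f g) (whom_tens h k) =
    ((-1) ^+ (p && q) *: whom_tens (whom_comp f h) (whom_comp g k))%R.
Proof.
move=> [t [ht [pt ->]]] [u [hu [pu ->]]].
have [v [hv ->]] := whomP f; have [w [hw ->]] := whomP k.
by rewrite !wE; apply/wclass_eq/st_interchange.
Qed.

Definition web_hom (a b : wobj) : superspace K :=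
  @Superspace K (whom K a b) (@whom_homog K a b) (@whom_homog0 K a b)
    (@whom_homog_lin K a b) (@whom_homog_dec a b) (@whom_homog_cap K a b).

End Operations.

Section Category.
Context (K : numFieldType).
Local Open Scope web_scope.

Definition web_supercategory : supercategory K :=
  @Supercategory K wobj web_hom whom_id whom_comp whom_id_even whom_comp_parity
    whom_comp_linl whom_comp_linr whom_compA whom_comp1l whom_comp1r.

Lemma eqhom_conj (a a' b b' : wobj) (ea : a = a') (eb : b = b') t u
    (ht : typed a b t) (hu : typed a' b' u) :
  structural t u \/ structural u t ->
  whom_comp (@eqhom K web_supercategory _ _ eb) (wclass ht) =
    whom_comp (wclass hu) (@eqhom K web_supercategory _ _ ea).
Proof.
case: _ / ea hu; case: _ / eb => hu h; rewrite whom_comp1l whom_comp1r.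
by case: h => h; [|apply: esym]; apply: wclass_eq.
Qed.

Lemma whom_tensA (a b c a' b' c' : wobj) (f : whom K a a') (g : whom K b b')
    (h : whom K c c') :
  whom_comp (@eqhom K web_supercategory _ _ (esym (catA a' b' c')))
      (whom_tens (whom_tens f g) h) =
    whom_comp (whom_tens f (whom_tens g h))
      (@eqhom K web_supercategory _ _ (esym (catA a b c))).
Proof.
have [t [ht ->]] := whomP f; have [u [hu ->]] := whomP g.
have [v [hv ->]] := whomP h; rewrite !whom_tensE.
by apply/eqhom_conj; right; apply: st_tensA.
Qed.

Lemma whom_tens1l (a b : wobj) (f : whom K a b) :
  whom_comp (@eqhom K web_supercategory _ _ (cat0s b))
      (whom_tens (whom_id [::]) f) =
    whom_comp f (@eqhom K web_supercategory _ _ (cat0s a)).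
Proof.
have [t [ht ->]] := whomP f; rewrite whom_tensE.
by apply/eqhom_conj; left; apply: st_tens1l.
Qed.

Lemma whom_tens1r (a b : wobj) (f : whom K a b) :
  whom_comp (@eqhom K web_supercategory _ _ (cats0 b))
      (whom_tens f (whom_id [::])) =
    whom_comp f (@eqhom K web_supercategory _ _ (cats0 a)).
Proof.
have [t [ht ->]] := whomP f; rewrite whom_tensE.
by apply/eqhom_conj; left; apply: st_tens1r.
Qed.

Definition qWeb : strict_monoidal_supercategory K :=
  @StrictMonoidalSupercategory K web_supercategory [::] (@cat nat) whom_tens
    (fun a b c => esym (catA a b c)) (@cat0s nat) (@cats0 nat) whom_tens_parity
    whom_tens_linl whom_tens_linr whom_tens_id whom_interchange
    whom_tensA whom_tens1l whom_tens1r.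

Definition web_beta (a b : seq nat) :
    @schom K qWeb (smobj (ups a : qWeb) (ups b)) (smobj (ups b : qWeb) (ups a)) :=
  wclass (typed_beta a b).

End Category.

(* Main.v *)
(** Up to the nonzero scalar [mult a], an object [a] is a retract of the bundle
    of [weight a] strands labelled 1, through the merges [thicken a] and the
    splits [thin a]. On such bundles the crossings behave as in the symmetric
    group: the relation EF - FE = k - l on the labels (2,1) and (1,2) gives the
    braid relation, and the relation between ladders and dots slides a dot
    through a crossing. As [splits k] after [merges k] is a polynomial in the
    crossings, every morphism lifts along [thicken] to a morphism built from
    crossings and dots, which is natural with respect to crossings of bundles.
    Since [thicken a] can be cancelled on the right, naturality, the hexagons
    and the symmetry reduce to the same identities for bundles. *)
Require Import Defs.
From HB Require Import structures.
From mathcomp Require Import all_boot all_order all_algebra.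
From mathcomp Require Import boolp reals complex zify.
From Stdlib Require Import Setoid Morphisms.

Set Implicit Arguments.
Unset Strict Implicit.
Unset Printing Implicit Defensive.

Import GRing.Theory Num.Theory.
Local Open Scope ring_scope.

(** * Calculus of formal expressions *)

Section Equivalence.
Context {K : numFieldType}.
Implicit Types f g h k t u : term K.
Local Open Scope web_scope.

(* Unlike [weq], this equivalence contains the structural laws without any
   well-formedness hypothesis, which makes it usable for rewriting. *)
Definition meq t u : Prop :=
  [/\ wf t = wf u, src t = src u, tgt t = tgt u & wf t -> weq t u].

Lemma meq_refl t : meq t t.
Proof. by split=> // _; apply: weq_refl. Qed.

Lemma meq_sym t u : meq t u -> meq u t.
Proof. by case=> w s g h; split=> // wu; apply/weq_sym/h; rewrite w. Qed.

Lemma meq_trans t u v : meq t u -> meq u v -> meq t v.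
Proof.
move=> [w s g h] [w' s' g' h']; split;
  [by rewrite w|by rewrite s|by rewrite g|].
by move=> wt; apply: weq_trans (h wt) _; apply: h'; rewrite -w.
Qed.

End Equivalence.

Notation "t ≈ u" := (meq t%W u%W) (at level 70, no associativity).

Add Parametric Relation (K : numFieldType) : (term K) (@meq K)
  reflexivity proved by (@meq_refl K)
  symmetry proved by (@meq_sym K)
  transitivity proved by (@meq_trans K) as meq_rel.

Add Parametric Morphism (K : numFieldType) : (@Cmp K)
  with signature (@meq K) ==> (@meq K) ==> (@meq K) as cmp_mor.
Proof.
move=> t t' [wt st tt ht] u u' [wu su tu hu]; split=> //=.
  by rewrite wt st wu tu.
by case/and3P=> /ht ? /hu ? _; apply: weq_cmp.
Qed.

Add Parametric Morphism (K : numFieldType) : (@Tns K)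
  with signature (@meq K) ==> (@meq K) ==> (@meq K) as tns_mor.
Proof.
move=> t t' [wt st tt ht] u u' [wu su tu hu]; split=> /=; try congruence.
by case/andP=> /ht ? /hu ?; apply: weq_tns.
Qed.

Add Parametric Morphism (K : numFieldType) : (@Add K)
  with signature (@meq K) ==> (@meq K) ==> (@meq K) as add_mor.
Proof.
move=> t t' [wt st tt ht] u u' [wu su tu hu]; split=> //=; try congruence.
by case/and4P=> /ht ? /hu ? _ _; apply: weq_add.
Qed.

Add Parametric Morphism (K : numFieldType) : (@Scl K)
  with signature (@eq K) ==> (@meq K) ==> (@meq K) as scl_mor.
Proof. by move=> c t t' [wt st tt ht]; split=> //= /ht; apply: weq_scl. Qed.

#[export] Hint Resolve meq_refl : core.

Section Calculus.
Context {K : numFieldType}.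
Implicit Types f g h k t u : term K.
Local Open Scope web_scope.

Lemma meq_structural t u : structural t u ->
  [/\ wf t = wf u, src t = src u & tgt t = tgt u] -> t ≈ u.
Proof.
move=> h [w s g]; split=> // wt; apply: weq_structural h.
by rewrite /parallel wt -w wt s g !eqxx.
Qed.

Lemma meq_relation t u : web_relation t u -> t ≈ u.
Proof.
move=> h; have /and4P[wt wu /eqP s /eqP g] := web_relation_parallel h.
by split=> //; [rewrite wt wu|move=> _; apply: weq_relation].
Qed.

Lemma cmpA f g h : f ∘ (g ∘ h) ≈ f ∘ g ∘ h.
Proof.
apply: meq_structural; first exact: st_compA.
by split=> //=; case: (wf f) (wf g) (wf h) => [] [] [] //=; rewrite andbC.
Qed.

Lemma cmp1l a f : tgt f = a -> Id a ∘ f ≈ f.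
Proof.
move=> <-; apply: meq_structural; first exact: st_comp1l.
by split=> //=; rewrite eqxx andbT.
Qed.

Lemma cmp1r a f : src f = a -> f ∘ Id a ≈ f.
Proof.
move=> <-; apply: meq_structural; first exact: st_comp1r.
by split=> //=; rewrite eqxx andbT.
Qed.

Lemma tnsA f g h : f ⊗ (g ⊗ h) ≈ (f ⊗ g) ⊗ h.
Proof.
apply: meq_structural; first exact: st_tensA.
by split; rewrite /= ?andbA ?catA.
Qed.

Lemma tns1l f : Id [::] ⊗ f ≈ f.
Proof. by apply: meq_structural; first exact: st_tens1l. Qed.

Lemma tns1r f : f ⊗ Id [::] ≈ f.
Proof.
by apply: meq_structural; [exact: st_tens1r|split; rewrite /= ?andbT ?cats0].
Qed.

Lemma tns_id a b : (Id a ⊗ Id b : term K) ≈ Id (a ++ b).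
Proof. by apply: meq_structural; first exact: st_tens_id. Qed.

(** The left side only compares the concatenated boundaries, whereas the right side compares them
    factor by factor; the two boundary equations make well-formedness agree. *)
Lemma meq_interchange f g h k p q : src f = tgt h -> src g = tgt k ->
    has_parity g p -> has_parity h q ->
  (f ⊗ g) ∘ (h ⊗ k) ≈ (-1) ^+ (p && q) *: ((f ∘ h) ⊗ (g ∘ k)).
Proof.
move=> e e' hg hh; apply: meq_structural; first exact: st_interchange.
split=> //=; rewrite e e' !eqxx.
by case: (wf f) (wf g) (wf h) (wf k) => [] [] [] [].
Qed.

Lemma sclA c d f : c *: (d *: f) ≈ (c * d)%R *: f.
Proof. by apply: meq_structural; first exact: st_sclA. Qed.

Lemma scl1 f : 1 *: f ≈ f.
Proof. by apply: meq_structural; first exact: st_scl1. Qed.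

Lemma cmpDl f g h : (f + g) ∘ h ≈ f ∘ h + g ∘ h.
Proof.
apply: meq_structural; first exact: st_compDl.
split=> //=; apply/and3P/and4P => [[/and4P[? ? /eqP <- /eqP <-] ? /eqP <-]|].
  by split; rewrite ?eqxx //; apply/and3P; split; rewrite ?eqxx.
move=> [/and3P[? ? /eqP ->] /and3P[? ? /eqP ->] _ ->].
by split; rewrite ?eqxx //; apply/and4P; split; rewrite ?eqxx.
Qed.

Lemma cmpDr f g h : f ∘ (g + h) ≈ f ∘ g + f ∘ h.
Proof.
apply: meq_structural; first exact: st_compDr.
split=> //=; apply/and3P/and4P => [[? /and4P[? ? /eqP <- /eqP <-] /eqP <-]|].
  by split; rewrite ?eqxx //; apply/and3P; split; rewrite ?eqxx.
move=> [/and3P[? ? /eqP <-] /and3P[? ? /eqP <-] -> _].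
by split; rewrite ?eqxx //; apply/and4P; split; rewrite ?eqxx.
Qed.

Lemma cmpZl c f g : (c *: f) ∘ g ≈ c *: (f ∘ g).
Proof. by apply: meq_structural; first exact: st_compZl. Qed.

Lemma cmpZr c f g : f ∘ (c *: g) ≈ c *: (f ∘ g).
Proof. by apply: meq_structural; first exact: st_compZr. Qed.

Lemma eqseq_cat2r (a b c : wobj) : (a ++ c == b ++ c) = (a == b).
Proof.
apply/eqP/eqP => [e|-> //]; have /eqP := congr1 size e.
by rewrite !size_cat eqn_add2r => /eqP s; move/eqP: e;
  rewrite eqseq_cat // => /andP[/eqP].
Qed.

Lemma tnsDl f g h : (f + g) ⊗ h ≈ f ⊗ h + g ⊗ h.
Proof.
apply: meq_structural; first exact: st_tensDl.
split=> //=; rewrite !eqseq_cat2r.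
by case: (wf f) (wf g) (wf h) => [] [] []; rewrite //= ?andbF ?andbT.
Qed.

Lemma tnsDr f g h : f ⊗ (g + h) ≈ f ⊗ g + f ⊗ h.
Proof.
apply: meq_structural; first exact: st_tensDr.
split=> //=; rewrite !eqseq_cat // !eqxx /=.
by case: (wf f) (wf g) (wf h) => [] [] []; rewrite //= ?andbF ?andbT.
Qed.

Lemma tnsZl c f g : (c *: f) ⊗ g ≈ c *: (f ⊗ g).
Proof. by apply: meq_structural; first exact: st_tensZl. Qed.

Lemma tnsZr c f g : f ⊗ (c *: g) ≈ c *: (f ⊗ g).
Proof. by apply: meq_structural; first exact: st_tensZr. Qed.


Lemma parity_dec t : wf t ->
  exists t0 t1, [/\ has_parity t0 false, has_parity t1 true & t ≈ t0 + t1].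
Proof.
move=> wt; have ht := typedI wt.
have [_ [_ [[t0 [h0 [p0 ->]]] [t1 [h1 [p1 ->]]] e]]] := whom_homog_dec (wclass
  ht).
exists t0, t1; split=> //; move: e; rewrite wclassD => /wclassP h.
by have [] := weq_same h; split.
Qed.

(** The interchange sign involves only the inner factors [g] and [h]. If one is even, the other may
    be inhomogeneous: it is split by [parity_dec] and each part is exchanged without sign. *)
Lemma tnsM f g h k : src f = tgt h -> src g = tgt k ->
    has_parity g false || has_parity h false ->
  (f ⊗ g) ∘ (h ⊗ k) ≈ (f ∘ h) ⊗ (g ∘ k).
Proof.
(* If one side is ill-formed, so is the other, and [meq] then only compares boundaries. *)
move=> e e'; wlog w : / wf ((f ⊗ g) ∘ (h ⊗ k)).
  case w : (wf _); first exact.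
  move=> _ _; split; rewrite ?w //.
  by move: w; rewrite /= e e' !eqxx;
    case: (wf f) (wf g) (wf h) (wf k) => [] [] [] [].
move: (w) => /= /and3P[/andP[wf_f wg] /andP[wh wk] _].
case/orP=> he.
- have [h0 [h1 [p0 p1 eh]]] := parity_dec wh.
  have [w' s' t' _] := eh; move: w';
    rewrite wh => /esym/= /and4P[_ _ /eqP s1 /eqP t1].
  rewrite /= in s' t'.
  rewrite eh tnsDl cmpDr (meq_interchange _ _ he p0) ?(meq_interchange _ _ he
    p1) -?t1 -?t' //.
  by rewrite cmpDr tnsDl !scl1.
- have [g0 [g1 [p0 p1 eg]]] := parity_dec wg.
  have [w' s' t' _] := eg; move: w';
    rewrite wg => /esym/= /and4P[_ _ /eqP s1 /eqP t1].
  rewrite /= in s' t'.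
  rewrite eg tnsDr cmpDl (meq_interchange _ _ p0 he) ?(meq_interchange _ _ p1
    he) -?s1 -?s' //.
  by rewrite cmpDl tnsDr !scl1.
Qed.

Lemma cmp_tnsl a f g : (Id a ⊗ f) ∘ (Id a ⊗ g) ≈ Id a ⊗ (f ∘ g).
Proof.
have [e|ne] := eqVneq (src f) (tgt g); first by rewrite tnsM ?cmp1l ?orbT.
(* With mismatched boundaries both sides are ill-formed. *)
by split; rewrite //= ?eqxx eqseq_cat // eqxx (negPf ne) !andbF.
Qed.

Lemma cmp_tnsr a f g : (f ⊗ Id a) ∘ (g ⊗ Id a) ≈ (f ∘ g) ⊗ Id a.
Proof.
have [e|ne] := eqVneq (src f) (tgt g); first by rewrite tnsM ?cmp1l.
by split; rewrite //= ?eqxx eqseq_cat2r (negPf ne) !andbF.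
Qed.

(** In this order the inner factors are identities, so no sign can arise. In the reverse order,
    treated next, they are [g] and [f] themselves, hence the evenness condition there. *)
Lemma tns_split a b f g : tgt g = b -> src f = a ->
  f ⊗ g ≈ (f ⊗ Id b) ∘ (Id a ⊗ g).
Proof. by move=> eb ea; rewrite tnsM ?cmp1l ?cmp1r. Qed.

Lemma tns_split_even a b f g : tgt f = a -> src g = b ->
    has_parity f false || has_parity g false ->
  f ⊗ g ≈ (Id a ⊗ g) ∘ (f ⊗ Id b).
Proof. by move=> ea eb p; rewrite tnsM ?cmp1l ?cmp1r // orbC. Qed.

Lemma tns_exch a a' b b' f g : src f = a -> tgt f = a' -> src g = b ->
    tgt g = b' -> has_parity f false || has_parity g false ->
  (f ⊗ Id b') ∘ (Id a ⊗ g) ≈ (Id a' ⊗ g) ∘ (f ⊗ Id b).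
Proof. by move=> *; rewrite -tns_split // -tns_split_even. Qed.

(* Transports linear algebra on formal expressions to the quotient modules; the
   value at an ill-typed expression is junk. *)
Definition cl a b t : whom K a b :=
  match boolP (typed a b t) with
  | AltTrue h => wclass h
  | AltFalse _ => 0%R
  end.

Lemma clE a b t (h : typed a b t) : cl a b t = wclass h.
Proof.
rewrite /cl; case: {-}_ / boolP => [h'|]; last by rewrite h.
exact/wclassP/weq_refl.
Qed.

Lemma clP a b t u : typed a b t -> typed a b u -> cl a b t = cl a b u <-> t ≈ u.
Proof.
move=> ht hu; rewrite (clE ht) (clE hu) wclassP; split=> [h|[_ _ _]].
  by have [] := weq_same h; split.
by apply; case/and3P: ht.
Qed.

Lemma clD a b t u : typed a b t -> typed a b u ->
  cl a b (t + u) = (cl a b t + cl a b u)%R.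
Proof. by move=> ht hu; rewrite (clE ht) (clE hu) (clE (typed_add ht hu))
  wclassD. Qed.

Lemma clZ a b c t : typed a b t -> cl a b (c *: t) = (c *: cl a b t)%R.
Proof. by move=> ht; rewrite (clE ht) (clE (typed_scl c ht)) wclassZ. Qed.

Lemma cl_cmp a b c t u : typed b c t -> typed a b u ->
  cl a c (t ∘ u) = whom_comp (cl b c t) (cl a b u).
Proof. by move=> ht hu; rewrite (clE ht) (clE hu) (clE (typed_cmp ht hu))
  whom_compE. Qed.

(** Solving a relation for one of its terms needs cancellation, which is carried out in the
    hom-space through [cl]. *)
Lemma subL a b f g h : typed a b f -> typed a b g -> typed a b h ->
  f - g ≈ h -> f ≈ h + g.
Proof.
move=> hf hg hh /(clP (typed_sub hf hg) hh).
rewrite clD // clZ // scaleN1r => e.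
by apply/(clP hf (typed_add hh hg)); rewrite clD // -e subrK.
Qed.

Lemma subR a b c f g h : typed a b f -> typed a b g -> typed a b h ->
  f - g ≈ (- c)%R *: h -> g ≈ c *: h + f.
Proof.
move=> hf hg hh /(clP (typed_sub hf hg) (typed_scl _ hh)).
rewrite clD // !clZ // scaleN1r scaleNr => e.
apply/(clP hg (typed_add (typed_scl _ hh) hf)); rewrite clD // clZ //.
by rewrite -[(c *: _)%R]opprK -e opprB subrK.
Qed.

End Calculus.

(** * The endomorphism ring of an object *)

Section EndRing.
Context (K : numFieldType) (a : wobj).

(** A separate name to carry the ring structure whose product is composition, so that identities
    between crossings become ring identities. *)
Definition wend := whom K a a.
HB.instance Definition _ := GRing.Zmodule.on wend.

Fact whom_comp_addl : left_distributive (@whom_comp K a a a) +%R.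
Proof.
by move=> f f' g; have := whom_comp_linl g 1%R f f'; rewrite !scale1r.
Qed.

Fact whom_comp_addr : right_distributive (@whom_comp K a a a) +%R.
Proof.
by move=> f g g'; have := whom_comp_linr f 1%R g g'; rewrite !scale1r.
Qed.

HB.instance Definition _ := GRing.Zmodule_isPzRing.Build wend
  (@whom_compA K a a a a) (@whom_comp1l K a a) (@whom_comp1r K a a)
  whom_comp_addl whom_comp_addr.

End EndRing.

(** * Crossings *)

Lemma pzring_invol (R : pzRingType) (t : R) :
  t * t = t *+ 2 -> (t - 1) * (t - 1) = 1.
Proof.
move=> e; rewrite mulrBl mulrBr e mul1r mulr1 mulr2n addrK.
by rewrite opprB addrC addrNK.
Qed.

(** Both sides expand to q - ab - ba + a + b - 1, which is symmetric in a and b. The elements a and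
    b will be the two ladders on three strands. *)
Lemma pzring_braid (R : pzRingType) (a b q : R) :
    a * a = a *+ 2 -> b * b = b *+ 2 ->
    a * b * a = a + q -> b * a * b = b + q ->
  (a - 1) * (b - 1) * (a - 1) = (b - 1) * (a - 1) * (b - 1).
Proof.
have expand (c d : R) : c * c = c *+ 2 -> c * d * c = c + q ->
    (c - 1) * (d - 1) * (c - 1) = q - d * c - c * d + (c + d) - 1.
  move=> cc cdc.
  have -> : (c - 1) * (d - 1) = c * d - c - (d - 1).
    by rewrite mulrBl mul1r mulrBr mulr1.
  rewrite mulrBr mulr1 !mulrBl mul1r cdc cc mulr2n [c + q]addrC !opprB.
  have -> : q + c - (c + c) = q - c by rewrite opprD addrA addrK.
  rewrite [q - c + _]addrA subrK -[in RHS]addrA -[in RHS]addrA; congr (_ + _).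
  by rewrite [RHS]addrC addrA; congr (_ - _); rewrite [LHS]addrC addrA.
move=> ea eb ha hb; rewrite (expand _ _ ea ha) (expand _ _ eb hb).
by congr (_ + _ - 1); [rewrite addrAC|rewrite addrC].
Qed.

Lemma pzring_slide (R : pzRingType) (t d d' : R) :
  d * t - t * d' = d - d' -> d * (t - 1) = (t - 1) * d'.
Proof.
move=> /eqP; rewrite subr_eq mulrBr mulr1 mulrBl mul1r => /eqP ->.
by rewrite -[d - d' + _]addrA addrAC subrr add0r addrC.
Qed.

Section Crossing.
Context {K : numFieldType}.
Implicit Types f g h k t u : term K.
Local Open Scope web_scope.

Lemma typedE a b t : typed a b t -> (wf t = true) * (src t = a) * (tgt t = b).
Proof. by case/and3P=> -> /eqP -> /eqP ->. Qed.

Definition wmergeE (k l : nat) := typedE (@typed_merge K k l).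
Definition wsplitE (k l : nat) := typedE (@typed_split K k l).
Definition wdotE (k : nat) := typedE (@typed_dot K k).
Definition mergesE (k : nat) := typedE (@typed_merges K k).
Definition splitsE (k : nat) := typedE (@typed_splits K k).
Definition crossingE := typedE (@typed_crossing K).
Definition tyE := (wmergeE, wsplitE, wdotE, mergesE, splitsE, crossingE).

End Crossing.

Ltac ty := rewrite /typed /= ?tyE ?addn1 /= -?catA ?eqxx //=.

(** * Ladders, and the relations satisfied by crossings of strands labelled 1 *)

Section Ladders.
Context {K : numFieldType}.
Implicit Types f g h k t u : term K.
Local Open Scope web_scope.

(** One plus the crossing; the defining relations are easier to read off for it than for the
    crossing. *)
Definition ladder : term K := wsplit 1 1 ∘ wmerge 1 1.

(** This is EF - FE = n on the labels (n+1, 1). In FE the second strand gets label 0 in the middle,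
    so FE collapses to the split after the merge. *)
Lemma EF_ladder n :
  (wmerge n 1 ⊗ \1_1) ∘ (\1_n ⊗ ladder) ∘ (wsplit n 1 ⊗ \1_1) ≈
    n%:R *: (\1_(n.+1) ⊗ \1_1) + wsplit n.+1 1 ∘ wmerge n.+1 1.
Proof.
apply: (@subL _ (up n.+1 ++ up 1) (up n.+1 ++ up 1)); try by ty.
have -> : n%:R = (n.+1%:R - 1%:R)%R :> K by rewrite -natrB // subn1.
apply: meq_trans (meq_relation (web_EF n.+1 1)).
rewrite /comp_EF /comp_FE !ltn0Sn /webE /webF /ladE /ladF !subSS !subn0
  [n.+1.-1]/=.
rewrite -cmp_tnsl !cmpA [wmerge 1 0]/= [wsplit 1 0]/= !tns1r !tns_id cmp1l
  ?cmp1r //; ty.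
Qed.

(** The mirror image, from the labels (1, n+1): now EF collapses, and the coefficient is 1 - (n+1) =
    -n. *)
Lemma FE_ladder n :
  (\1_1 ⊗ wmerge 1 n) ∘ (ladder ⊗ \1_n) ∘ (\1_1 ⊗ wsplit 1 n) ≈
    n%:R *: (\1_1 ⊗ \1_n.+1) + wsplit 1 n.+1 ∘ wmerge 1 n.+1.
Proof.
apply: (@subR _ (up 1 ++ up n.+1) (up 1 ++ up n.+1)); try by ty.
have -> : (- n%:R = 1%:R - n.+1%:R :> K)%R by rewrite -[n.+1%:R%R]natr1 opprD
  addrCA subrr addr0.
apply: meq_trans (meq_relation (web_EF 1 n.+1)).
rewrite /comp_EF /comp_FE !ltn0Sn /webE /webF /ladE /ladF !subSS !subn0.
rewrite -cmp_tnsr !cmpA [wmerge 0 1]/= [wsplit 0 1]/= !tns1l !tns_id cmp1l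
  ?cmp1r //; ty.
Qed.

Lemma cl_sub1 a t : typed a a t ->
  cl a a (t - Id a) = ((cl a a t : wend K a) - 1)%R.
Proof.
by move=> ht; rewrite (clD ht (typed_scl _ (typed_id a))) clZ ?typed_id //
  scaleN1r (clE (typed_id a)).
Qed.

Lemma cl_endM a t u : typed a a t -> typed a a u ->
  cl a a (t ∘ u) = ((cl a a t : wend K a) * cl a a u)%R.
Proof. exact: cl_cmp. Qed.

Lemma crossingD : crossing ≈ ladder - Id (ones 2).
Proof. by rewrite /crossing tns_id. Qed.

(** In a left-nested composite the last factors do not form a subexpression; this and the next lemma
    allow them to be rewritten there. *)
Lemma cmp2 a b r : a ∘ b ≈ r -> forall f, f ∘ a ∘ b ≈ f ∘ r.
Proof. by move=> e f; rewrite -e cmpA. Qed.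

Lemma cmp3 a b c r : a ∘ b ∘ c ≈ r -> forall f, f ∘ a ∘ b ∘ c ≈ f ∘ r.
Proof. by move=> e f; rewrite -e !cmpA. Qed.

Lemma ladder_sq : ladder ∘ ladder ≈ 2%:R *: ladder.
Proof.
rewrite /ladder cmpA -[_ ∘ wsplit 1 1]cmpA (meq_relation (web_digon 1 1)).
by rewrite cmpZr cmpZl cmp1r.
Qed.

Lemma crossing_invol : (crossing : term K) ∘ crossing ≈ Id (ones 2).
Proof.
have tT : typed (ones 2) (ones 2) ladder by [].
rewrite crossingD; apply/(@clP _ (ones 2) (ones 2)) => //.
rewrite cl_endM // cl_sub1 // [RHS](clE (typed_id _));
  apply: (@pzring_invol (wend K (ones 2))).
by rewrite -cl_endM // -scaler_nat -clZ //;
  apply/(@clP _ (ones 2) (ones 2))/ladder_sq.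
Qed.

(** With A and B the ladders on the first and last two of three strands, [EF_ladder] and [FE_ladder]
    at n = 1 give ABA = A + Q and BAB = B + Q for the same Q, which merges all three strands and
    splits them again. Then [pzring_braid] applies. *)
Lemma crossing_braid :
  (crossing ⊗ \1_1 : term K) ∘ (\1_1 ⊗ crossing) ∘ (crossing ⊗ \1_1) ≈
    (\1_1 ⊗ crossing) ∘ (crossing ⊗ \1_1) ∘ (\1_1 ⊗ crossing).
Proof.
pose A := ladder ⊗ \1_1; pose B := \1_1 ⊗ ladder.
pose Q := (wsplit 1 1 ⊗ \1_1) ∘ wsplit 2 1 ∘ wmerge 2 1 ∘ (wmerge 1 1 ⊗ \1_1) :
  term K.
have tA : typed (ones 3) (ones 3) A by [].
have tB : typed (ones 3) (ones 3) B by [].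
have tQ : typed (ones 3) (ones 3) Q by [].
have -> : crossing ⊗ \1_1 ≈ A - Id (ones 3).
  by rewrite crossingD tnsDl tnsZl tns_id.
have -> : \1_1 ⊗ crossing ≈ B - Id (ones 3).
  by rewrite crossingD tnsDr tnsZr tns_id.
have AA : A ∘ A ≈ 2%:R *: A by rewrite cmp_tnsr ladder_sq tnsZl.
have BB : B ∘ B ≈ 2%:R *: B by rewrite cmp_tnsl ladder_sq tnsZr.
have ABA : A ∘ B ∘ A ≈ A + Q.
  rewrite {1 2}/A /ladder -!cmp_tnsr !cmpA.
  rewrite (cmp3 (EF_ladder 1)) cmpDr cmpDl scl1 tns_id cmp1r // cmpA.
  by rewrite /A /ladder -cmp_tnsr.
have BAB : B ∘ A ∘ B ≈ B + Q.
  rewrite {1 2}/B /ladder -!cmp_tnsl !cmpA.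
  rewrite (cmp3 (FE_ladder 1)) cmpDr cmpDl scl1 tns_id cmp1r // cmpA cmp_tnsl
    -/ladder.
  (* Here the three strands are merged and split from the right; associativity turns this into Q. *)
  rewrite -(meq_relation (web_splitA 1 1 1)) -[_ ∘ wmerge 1 2 ∘ _]cmpA.
  by rewrite -(meq_relation (web_mergeA 1 1 1)) cmpA.
apply/(@clP _ (ones 3) (ones 3)) => //.
rewrite !(cl_endM, cl_sub1) //;
  apply: (@pzring_braid (wend K (ones 3)) _ _ (cl (ones 3) (ones 3) Q)).
- by rewrite -cl_endM // -scaler_nat -clZ //; apply/(@clP _ (ones 3) (ones 3)).
- by rewrite -cl_endM // -scaler_nat -clZ //; apply/(@clP _ (ones 3) (ones 3)).
- by rewrite -!cl_endM // -clD //; apply/(@clP _ (ones 3) (ones 3)).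
- by rewrite -!cl_endM // -clD //; apply/(@clP _ (ones 3) (ones 3)).
Qed.

Lemma crossing_dot :
  crossing ∘ (wdot 1 ⊗ \1_1) ≈ (\1_1 ⊗ wdot 1) ∘ (crossing : term K).
Proof.
(* On the labels (1,1) the dotted ladder relation has edges labelled 0, and both composites become
   the ladder with a dot after or before it. *)
have e : (wdot 1 ⊗ \1_1) ∘ ladder - ladder ∘ (\1_1 ⊗ wdot 1) ≈
    wdot 1 ⊗ \1_1 - \1_1 ⊗ wdot 1.
  apply: meq_trans (meq_relation (web_dEF 1 1)).
  rewrite /comp_EF /comp_FE !ltn0Sn /webdE /webF /ladF /webE !subSS !subn0.
  rewrite [wmerge 1.-1 1]/= [wmerge 1 1.-1]/= [wsplit 0 1]/= [wsplit 1 0]/=.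
  rewrite !(tns1l, tns1r) !tns_id !cmpA.
  by rewrite !(cmp1l, cmp1r) // !cmpA.
have slide : (wdot 1 ⊗ \1_1) ∘ crossing ≈ (crossing : term K) ∘ (\1_1 ⊗ wdot 1).
  have tL : typed (ones 2) (ones 2) ladder by [].
  rewrite crossingD; move: ladder tL e => L tL e.
  have tLI := typed_sub tL (typed_id (ones 2)).
  have [tD tD'] : typed (ones 2) (ones 2) (wdot 1 ⊗ \1_1 : term K) /\
    typed (ones 2) (ones 2) (\1_1 ⊗ wdot 1 : term K) by [].
  move: (wdot 1 ⊗ \1_1 : term K) (\1_1 ⊗ wdot 1 : term K) tD tD' e => D D' tD
    tD' e.
  apply/(clP (typed_cmp tD tLI) (typed_cmp tLI tD')).
  rewrite !(cl_endM, cl_sub1) //; apply: (@pzring_slide (wend K (ones 2))).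
  move/(clP (typed_sub (typed_cmp tD tL) (typed_cmp tL tD')) (typed_sub tD
    tD')): e.
  rewrite !clD ?clZ ?scaleN1r ?cl_endM //; first exact: typed_cmp tL tD'.
    exact: typed_cmp tD tL.
  exact: typed_cmp tL tD'.
(* The opposite slide follows by conjugation: with x the crossing, x d = x d x x = x x d' x = d'
   x. *)
rewrite -[wdot 1 ⊗ _](@cmp1r _ (ones 2)) // -crossing_invol !cmpA.
by rewrite (cmp2 slide crossing) cmpA crossing_invol cmp1l.
Qed.
End Ladders.

(** * Bundles of thin strands *)

Notation "\I_ k" := (Id (ones k)) (at level 8, k at level 2, format "\I_ k") :
  web_scope.
Arguments ones : simpl never.

Section Blocks.
Context {K : numFieldType}.
Implicit Types (f g h t u : term K) (w : seq nat) (k l m n p : nat).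
Local Open Scope web_scope.

Definition word n w : term K :=
  foldl (fun t i => crossing_at n i ∘ t) \I_n w.

Definition in_range n w := all (fun i => i.+1 < n)%N w.

Lemma in_range_rcons n w i :
  in_range n (rcons w i) = (i.+1 < n)%N && in_range n w.
Proof. by rewrite /in_range all_rcons. Qed.

Lemma word_rcons n w i : word n (rcons w i) = crossing_at n i ∘ word n w.
Proof. by rewrite /word foldl_rcons. Qed.

Lemma typed_word n w : in_range n w -> typed (ones n) (ones n) (word n w).
Proof.
elim/last_ind: w => [|w i IH]; first by move=> _; apply: typed_id.
rewrite in_range_rcons word_rcons => /andP[hi hw].
exact: typed_cmp (typed_crossing_at hi) (IH hw).
Qed.

Lemma word_cat n w w' : in_range n w ->
  word n (w ++ w') ≈ word n w' ∘ word n w.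
Proof.
move=> hw; elim/last_ind: w' => [|w' i IH].
  by rewrite cats0 cmp1l // (typedE (typed_word hw)).
by rewrite -rcons_cat !word_rcons IH cmpA.
Qed.

Lemma word_shift m n w : \I_m ⊗ word n w ≈ word (m + n) (map (addn m) w).
Proof.
elim/last_ind: w => [|w i IH]; first by rewrite /= tns_id ones_cat.
rewrite map_rcons !word_rcons -cmp_tnsl IH /crossing_at tnsA tns_id ones_cat.
by have -> : (m + n - (m + i) - 2 = n - i - 2)%N by lia.
Qed.

Lemma word_widen m n w : in_range n w -> word n w ⊗ \I_m ≈ word (n + m) w.
Proof.
elim/last_ind: w => [|w i IH]; first by rewrite /= tns_id ones_cat.
rewrite in_range_rcons => /andP[hi hw].
rewrite !word_rcons -cmp_tnsr IH // /crossing_at -!tnsA tns_id ones_cat.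
(* The range condition keeps this truncated subtraction exact. *)
by have -> : (n + m - i - 2 = n - i - 2 + m)%N by lia.
Qed.

Lemma in_range_block m n : in_range (m + n) (block_word m n).
Proof.
by apply/allP => p /allpairsP[[i j] [/= + + ->]]; rewrite mem_rev !mem_iota;
  lia.
Qed.

Lemma block_crossingE m n : block_crossing m n = word (m + n) (block_word m n).
Proof. by []. Qed.

Definition blockE (m n : nat) := typedE (@typed_block_crossing K m n).

End Blocks.

Ltac os := by rewrite /= ?tyE ?blockE -?catA ?ones_cat; congr ones; lia.

(** * Crossings of bundles, and the morphisms that are natural for them *)

Section Naturality.
Context {K : numFieldType}.
Implicit Types (f g h t u : term K) (w : seq nat) (k l m n p : nat).
Local Open Scope web_scope.

Lemma even_block m n : has_parity (block_crossing m n : term K) false.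
Proof.
rewrite block_crossingE; elim/last_ind: (block_word m n) => // w i IH.
by rewrite word_rcons /= IH.
Qed.

Lemma block_wordDl m m' n :
  block_word (m + m') n = map (addn m) (block_word m' n) ++ block_word m n.
Proof.
rewrite /block_word iotaD rev_cat allpairs_cat; congr (_ ++ _).
rewrite -[(0 + m)%N]addn0 iotaDl -map_rev allpairs_mapl map_allpairs.
by apply: eq_allpairs => // i j; rewrite add0n addnA.
Qed.

(** An equality of words only for a single moving strand; for larger blocks the two words differ by
    commuting distant crossings, which [block_crossing_hexr] handles. *)
Lemma block_wordDr n n' :
  block_word 1 (n + n') = block_word 1 n ++ map (addn n) (block_word 1 n').
Proof.
rewrite /block_word /= !cats0 iotaD map_cat; congr (_ ++ _).
by rewrite -[(0 + n)%N]addn0 iotaDl -!map_comp; apply: eq_map => j /=; lia.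
Qed.

Lemma block_crossing_hexl m m' n :
  (block_crossing (m + m') n : term K) ≈
    (block_crossing m n ⊗ \I_m') ∘ (\I_m ⊗ block_crossing m' n).
Proof.
rewrite !block_crossingE block_wordDl word_cat; last first.
  apply/allP => p /mapP[i /(allP (in_range_block m' n)) + ->]; lia.
rewrite word_shift word_widen ?in_range_block //.
by rewrite -!addnA [(m' + n)%N]addnC.
Qed.

Lemma block_crossing_hexr1 n n' :
  (block_crossing 1 (n + n') : term K) ≈
    (\I_n ⊗ block_crossing 1 n') ∘ (block_crossing 1 n ⊗ \I_n').
Proof.
rewrite !block_crossingE block_wordDr word_cat; last first.
  by apply/allP => p /(allP (in_range_block 1 n)); lia.
rewrite word_shift word_widen ?in_range_block //.
by rewrite addnA addnCA addnA.
Qed.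

Lemma tnsIIl m n f : \I_m ⊗ (\I_n ⊗ f) ≈ \I_(m + n)%N ⊗ f.
Proof. by rewrite tnsA tns_id ones_cat. Qed.

Lemma tnsIIr m n f : (f ⊗ \I_m) ⊗ \I_n ≈ f ⊗ \I_(m + n)%N.
Proof. by rewrite -tnsA tns_id ones_cat. Qed.

Lemma block_crossing0l n : (block_crossing 0 n : term K) = \I_n.
Proof. by []. Qed.

Lemma block_crossing0r n : (block_crossing n 0 : term K) = \I_n.
Proof. by rewrite block_crossingE /block_word allpairs0r addn0. Qed.

Lemma block_crossing11 : (block_crossing 1 1 : term K) ≈ crossing.
Proof. by rewrite block_crossingE -[block_word 1 1]/(rcons [::] 0%N) word_rcons
  cmp1r // /crossing_at tns1l tns1r. Qed.

Lemma block_crossing_hexr m n n' :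
  (block_crossing m (n + n') : term K) ≈
    (\I_n ⊗ block_crossing m n') ∘ (block_crossing m n ⊗ \I_n').
Proof.
elim: m => [|m IH].
  by rewrite !block_crossing0l !tns_id cmp1l // ones_cat.
rewrite -addn1 !block_crossing_hexl IH block_crossing_hexr1.
rewrite -!cmp_tnsr -!cmp_tnsl !cmpA !tnsIIr !tnsIIl -!tnsA.
rewrite -[_ ∘ (\I_(m + n)%N ⊗ _)]cmpA.
(* The first m strands crossing n and the last strand crossing n' occupy disjoint positions, and
   both crossings are even, so they commute. *)
rewrite (@tns_exch _ _ (ones (n + m)) (ones (n' + 1)) _ (block_crossing m n))
  ?blockE ?even_block //; try os.
by rewrite cmpA [(1 + n')%N]addnC.
Qed.

Lemma block_crossing_invol1 n :
  (block_crossing n 1 : term K) ∘ block_crossing 1 n ≈ \I_(n + 1)%N.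
Proof.
elim: n => [|n IH]; first by rewrite block_crossing0r block_crossing0l cmp1l.
rewrite -[in X in X ∘ _]addn1 -[n.+1]addn1 block_crossing_hexl
  block_crossing_hexr.
rewrite cmpA -[_ ∘ _ ∘ (\I_n ⊗ _)]cmpA cmp_tnsl block_crossing11 crossing_invol.
by rewrite tns_id cmp1r ?cmp_tnsr ?IH ?tns_id ?ones_cat //; os.
Qed.

(** Splitting one strand off the m-bundle by both hexagons, the inner pair cancels by induction and
    the outer pair by the single-strand case. *)
Lemma block_crossing_invol m n :
  (block_crossing n m : term K) ∘ block_crossing m n ≈ \I_(m + n)%N.
Proof.
elim: m => [|m IH]; first by rewrite block_crossing0r block_crossing0l cmp1l.
rewrite -addn1 block_crossing_hexl block_crossing_hexr.
rewrite cmpA -[_ ∘ _ ∘ (block_crossing m n ⊗ _)]cmpA cmp_tnsr IH.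
rewrite tns_id cmp1r ?cmp_tnsl ?block_crossing_invol1 ?tns_id ?ones_cat //;
  try os.
by rewrite -addnA [(1 + n)%N]addnC.
Qed.

(** Naturality is tested only against identity bundles, where no sign occurs; odd morphisms such as
    dots are thus covered. *)
Definition thin_natural m m' f := [/\ src f = ones m, tgt f = ones m' &
  forall n, block_crossing m' n ∘ (f ⊗ \I_n) ≈ (\I_n ⊗ f) ∘ block_crossing m n].

Lemma thin_natural_id m : thin_natural m m \I_m.
Proof. by split=> // n; rewrite !tns_id cmp1l ?cmp1r ?blockE; try os. Qed.

Lemma thin_natural_cmp m m' m'' f g : thin_natural m' m'' f ->
  thin_natural m m' g -> thin_natural m m'' (f ∘ g).
Proof.
move=> [_ tf ef] [sg _ eg]; split=> // n.
by rewrite -cmp_tnsr cmpA ef -cmpA eg cmpA cmp_tnsl.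
Qed.

Lemma thin_natural_add m m' f g : thin_natural m m' f ->
  thin_natural m m' g -> thin_natural m m' (f + g).
Proof.
move=> [sf tf ef] [sg tg eg]; split=> // n.
by rewrite tnsDl cmpDr ef eg -cmpDl tnsDr.
Qed.

Lemma thin_natural_scl c m m' f : thin_natural m m' f ->
  thin_natural m m' (c *: f).
Proof.
move=> [sf tf ef]; split=> // n.
by rewrite tnsZl cmpZr ef -cmpZl tnsZr.
Qed.

(** No structural law composes or tensors with [Zero]. It is rewritten as a zero multiple, the
    scalar is pulled out, and this lemma compares the results. *)
Lemma scl0 a b f g : typed a b f -> typed a b g -> 0%R *: f ≈ 0%R *: g.
Proof.
move=> hf hg; apply/(clP (typed_scl 0%R hf) (typed_scl 0%R hg)).
by rewrite !clZ // !scale0r.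
Qed.

Lemma thin_natural_zero m m' : thin_natural m m' (Zero (ones m) (ones m')).
Proof.
split=> // n.
have -> : (Zero (ones m) (ones m') : term K) ≈ 0%R *: Zero (ones m) (ones m').
  by split=> // _; apply: weq_scl_zero.
rewrite tnsZl tnsZr cmpZl cmpZr; apply: (@scl0 (ones (m + n)) (ones (m' + n))).
  by rewrite /typed /= !blockE !ones_cat !eqxx.
by rewrite /typed /= !blockE !ones_cat [(n + m)%N]addnC [(n + m')%N]addnC !eqxx.
Qed.

Lemma thin_natural_tnsr p m m' f : thin_natural m m' f ->
  thin_natural (m + p) (m' + p) (f ⊗ \I_p).
Proof.
move=> [sf tf ef]; split=> [||n]; rewrite /= ?sf ?tf ?ones_cat //.
rewrite !block_crossing_hexl tnsIIr -cmpA.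
rewrite -(@tns_exch _ (ones m) (ones m') _ _ f) ?blockE ?even_block ?orbT //.
rewrite cmpA [(p + n)%N]addnC -!tnsIIr cmp_tnsr ef -cmp_tnsr -cmpA.
by rewrite -tnsA.
Qed.

Lemma thin_natural_tnsl p m m' f : thin_natural m m' f ->
  thin_natural (p + m) (p + m') (\I_p ⊗ f).
Proof.
move=> [sf tf ef]; split=> [||n]; rewrite /= ?sf ?tf ?ones_cat //.
rewrite !block_crossing_hexl -tnsA -cmpA cmp_tnsl ef -cmp_tnsl tnsIIl cmpA.
rewrite (@tns_exch _ _ (ones (n + p)) (ones m) _ _ f) ?blockE ?even_block ?sf
  ?tf //; try os.
by rewrite -cmpA tnsIIl.
Qed.

Lemma thin_natural_tns m m' p p' f g : thin_natural m m' f ->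
  thin_natural p p' g -> thin_natural (m + p) (m' + p') (f ⊗ g).
Proof.
move=> nf ng; have [sf tf _] := nf; have [sg tg _] := ng.
have [_ _ efg] := thin_natural_cmp (thin_natural_tnsr p' nf) (thin_natural_tnsl
  m ng).
split=> [||n]; rewrite /= ?sf ?tf ?sg ?tg ?ones_cat //.
by rewrite (tns_split tg sf) efg.
Qed.

(** A bundle can be crossed one strand at a time, by the hexagon. *)
Lemma thin_natural1 m m' f : src f = ones m -> tgt f = ones m' ->
    block_crossing m' 1 ∘ (f ⊗ \I_1) ≈ (\I_1 ⊗ f) ∘ block_crossing m 1 ->
  thin_natural m m' f.
Proof.
move=> sf tf e1; split=> //; elim=> [|n IH].
  by rewrite !block_crossing0r tns1l tns1r cmp1l ?cmp1r // ?sf ?tf.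
rewrite -addn1 !block_crossing_hexr -tnsIIr -cmpA cmp_tnsr IH -cmp_tnsr cmpA.
by rewrite -tnsA cmp_tnsl e1 -cmp_tnsl -cmpA tnsIIl.
Qed.

Lemma thin_natural_dot : thin_natural 1 1 (wdot 1).
Proof. by apply: thin_natural1 => //;
  rewrite block_crossing11 crossing_dot. Qed.

Lemma thin_natural_crossing : thin_natural 2 2 crossing.
Proof.
apply: thin_natural1 => //.
(* Against one strand, naturality of the crossing is the braid relation. *)
by rewrite (block_crossing_hexl 1 1 1) block_crossing11 cmpA -crossing_braid.
Qed.

Lemma thin_natural_transport m m' f g : f ≈ g -> thin_natural m m' f ->
  thin_natural m m' g.
Proof.
move=> e [sf tf ef]; have [_ sg tg _] := e; split; rewrite -?sg -?tg // => n.
by rewrite -e.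
Qed.

(** Conjugation by the inverse block crossings moves the passive bundle to the other side. *)
Lemma thin_natural_r m m' f n : thin_natural m m' f ->
  block_crossing n m' ∘ (\I_n ⊗ f) ≈ (f ⊗ \I_n) ∘ block_crossing n m.
Proof.
move=> [sf tf ef].
rewrite -[\I_n ⊗ f](@cmp1r _ (ones (n + m))) ?sf ?ones_cat //.
rewrite -block_crossing_invol [\I_n ⊗ f ∘ _]cmpA -ef !cmpA block_crossing_invol
  cmp1l //.
  by rewrite /= tf ones_cat.
by rewrite /= sf ones_cat.
Qed.

End Naturality.

(** * Thick strands *)

Section Thick.
Context {K : numFieldType}.
Implicit Types (f g h t u : term K) (k l m n p : nat) (a b : wobj).
Local Open Scope web_scope.

Lemma meq_sclI (c : K) f g : c != 0%R -> c *: f ≈ c *: g -> f ≈ g.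
Proof.
move=> c0 e; rewrite -(scl1 f) -(scl1 g) -(mulVf c0) -!sclA.
by rewrite e.
Qed.

(** Put one plus the crossing for the ladder in [EF_ladder]: its identity part closes up to a digon
    with value n+1, and subtracting n leaves one identity. *)
Lemma ladder_rec n :
  wsplit n.+1 1 ∘ wmerge n.+1 1 ≈
    (wmerge n 1 ⊗ \1_1) ∘ (\1_n ⊗ (crossing : term K)) ∘ (wsplit n 1 ⊗ \1_1)
      + Id (up n.+1 ++ up 1).
Proof.
set S := wsplit n.+1 1 ∘ _; set Y := _ ∘ (wsplit n 1 ⊗ \1_1); set I := Id _.
have tS : typed (up n.+1 ++ up 1) (up n.+1 ++ up 1) S by ty.
have tY : typed (up n.+1 ++ up 1) (up n.+1 ++ up 1) Y by ty.
have tI := typed_id (up n.+1 ++ up 1) : typed _ _ I.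
have L : (ladder : term K) ≈ crossing + Id (ones 2).
  by apply: (@subL _ (ones 2) (ones 2)) => //; rewrite -crossingD.
have := EF_ladder (K := K) n; rewrite -/S tns_id.
rewrite {1}L tnsDr cmpDr cmpDl -/Y tns_id cmp1r; last by ty.
rewrite cmp_tnsr (meq_relation (web_digon n 1)) tnsZl tns_id bin1 addn1.
rewrite -/I.
have tYI c := typed_add tY (typed_scl c tI);
  have tIS c := typed_add (typed_scl c tI) tS.
move/(clP (tYI _) (tIS _)); rewrite !clD // !clZ // -natr1 scalerDl scale1r =>
  e.
apply/(clP tS (typed_add tY tI)); rewrite clD //.
by apply: (addrI (n%:R *: cl _ _ I)%R); rewrite -e addrCA.
Qed.

Lemma mergesS k : merges k.+1 = wmerge k 1 ∘ (merges k ⊗ \1_1) :> term K.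
Proof. by []. Qed.

Lemma splitsS k : splits k.+1 = (splits k ⊗ \1_1) ∘ wsplit k 1 :> term K.
Proof. by []. Qed.

Lemma even_merges k : has_parity (merges k : term K) false.
Proof. by elim: k => //= k ->; rewrite even_merge. Qed.

Lemma even_splits k : has_parity (splits k : term K) false.
Proof. by elim: k => //= k ->; rewrite even_split. Qed.

(** By [merges_splits] this is k! times an idempotent, the analogue of the sum of all permutations
    of k strands. *)
Definition clasp k : term K := splits k ∘ merges k.

Lemma merges_splits k : merges k ∘ splits k ≈ k`!%:R *: (\1_k : term K).
Proof.
elim: k => [|k IH]; first by rewrite cmp1l // scl1.
rewrite /= cmpA -[_ ∘ _ ∘ (splits k ⊗ _)]cmpA cmp_tnsr IH tnsZl cmpZr cmpZl.
rewrite tns_id cmp1r; last by ty.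
rewrite (meq_relation (web_digon k 1)) sclA bin1 -natrM addn1.
by rewrite factS mulnC.
Qed.

(* EF - FE on the labels (n+1, 1), with the middle strand of label n blown up
   into a bundle; hence a clasp is a polynomial in the crossings. *)
Lemma clasp_rec n : clasp n.+2 ≈
  (n`!%:R)^-1 *: ((clasp n.+1 ⊗ \1_1) ∘ (\I_n ⊗ crossing) ∘ (clasp n.+1 ⊗ \1_1))
    + clasp n.+1 ⊗ \1_1.
Proof.
have nz : n`!%:R != 0%R :> K by rewrite pnatr_eq0 -lt0n fact_gt0.
rewrite {1}/clasp -[splits n.+2]/((splits n.+1 ⊗ \1_1) ∘ wsplit n.+1 1).
rewrite -[merges n.+2]/(wmerge n.+1 1 ∘ (merges n.+1 ⊗ \1_1)).
rewrite cmpA -[_ ∘ wsplit n.+1 1 ∘ _]cmpA ladder_rec.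
have -> : \1_n ⊗ crossing ≈ (n`!%:R)^-1 *: (((merges n ⊗ \1_1) ⊗ \1_1) ∘
    (\I_n ⊗ (crossing : term K)) ∘ ((splits n ⊗ \1_1) ⊗ \1_1)).
  rewrite -!tnsA tns_id -(tns_split (a := ones n) (b := ones 2)) ?mergesE //.
  rewrite tnsM ?splitsE ?mergesE // merges_splits cmp1r // tnsZl sclA mulVf //.
  by rewrite scl1.
rewrite cmpDr cmpDl cmp1r; last by ty.
rewrite !cmp_tnsr; apply: add_mor => //.
rewrite !(cmpZr, cmpZl); apply: scl_mor => //.
rewrite /clasp mergesS splitsS; move: (merges n) (splits n) => M S.
by rewrite -!cmp_tnsr !cmpA.
Qed.

(** The recursion builds clasps from crossings by tensoring with identities, composing, scaling and
    adding, all of which preserve naturality. *)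
Lemma thin_natural_clasp k : thin_natural k k (clasp k).
Proof.
elim: k => [|[|n] IH].
- by apply: thin_natural_transport (thin_natural_id _); rewrite /clasp cmp1l.
- apply: thin_natural_transport (thin_natural_id _).
  by rewrite /clasp /= !tns_id !cmp1l.
- apply: thin_natural_transport (meq_sym (clasp_rec n)) _.
  have h := thin_natural_tnsr 1 IH; rewrite addn1 in h.
  apply: (thin_natural_add _ h); apply: thin_natural_scl.
  apply: (thin_natural_cmp _ h); apply: (thin_natural_cmp h).
  by have := thin_natural_tnsl n thin_natural_crossing; rewrite addn2.
Qed.

Lemma merges_cat k l : wmerge k l ∘ (merges k ⊗ merges l) ≈
  (merges (k + l) : term K).
Proof.
elim: l => [|l IH]; first by rewrite tns1r /wmerge andbF cmp1l ?mergesE addn0.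
rewrite addnS !mergesS -IH -cmp_tnsr.
rewrite cmpA (meq_relation (web_mergeA k l 1)) addn1 -cmpA -tnsA.
by rewrite tnsM ?cmp1l ?mergesE //= ?tyE ?addn1 // even_merges orbT.
Qed.

Lemma splits_cat k l : (splits k ⊗ splits l) ∘ wsplit k l ≈
  (splits (k + l) : term K).
Proof.
elim: l => [|l IH]; first by rewrite tns1r /wsplit andbF cmp1r ?splitsE addn0.
rewrite addnS !splitsS -IH -cmp_tnsr -cmpA (meq_relation (web_splitA k l 1))
  addn1.
rewrite cmpA -tnsA tnsM ?cmp1r ?splitsE //= ?tyE ?addn1 //.
by rewrite even_splits.
Qed.

(** A letter [n] stands for the label n+1, hence the successor. *)
Definition weight a := sumn (map S a).

Fixpoint thicken a : term K :=
  if a is n :: a' then merges n.+1 ⊗ thicken a' else Id [::].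

Fixpoint thin a : term K :=
  if a is n :: a' then splits n.+1 ⊗ thin a' else Id [::].

Definition mult a : K := (\prod_(n <- a) n.+1`!)%N%:R.

Lemma typed_thicken a : typed (ones (weight a)) a (thicken a).
Proof.
elim: a => // n a IH; rewrite /weight /= -ones_cat.
exact: typed_tns (typed_merges n.+1) IH.
Qed.

Lemma typed_thin a : typed a (ones (weight a)) (thin a).
Proof.
elim: a => // n a IH; rewrite /weight /= -ones_cat.
exact: typed_tns (typed_splits n.+1) IH.
Qed.

Definition thickenE a := typedE (typed_thicken a).
Definition thinE a := typedE (typed_thin a).

Lemma even_thicken a : has_parity (thicken a) false.
Proof. by elim: a => //= n a ->; rewrite even_merge even_merges. Qed.

Lemma even_thin a : has_parity (thin a) false.
Proof. by elim: a => //= n a ->; rewrite even_split even_splits. Qed.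

Lemma weight_cat a b : weight (a ++ b) = (weight a + weight b)%N.
Proof. by rewrite /weight map_cat sumn_cat. Qed.

Lemma weight_up k : weight (up k) = k.
Proof. by case: k => //= k; rewrite /weight /= addn0. Qed.

Lemma thicken_cat a b : thicken (a ++ b) ≈ thicken a ⊗ thicken b.
Proof. by elim: a => [|n a IH]; rewrite /= ?tns1l // IH tnsA. Qed.

Lemma thicken_up k : thicken (up k) ≈ merges k.
Proof. by case: k => //= k; rewrite tns1r. Qed.

Lemma thin_up k : thin (up k) ≈ splits k.
Proof. by case: k => //= k; rewrite tns1r. Qed.

Lemma mult_neq0 a : mult a != 0%R.
Proof.
rewrite pnatr_eq0 -lt0n; elim: a => [|n a IH]; first by rewrite big_nil.
by rewrite big_cons muln_gt0 fact_gt0.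
Qed.

Lemma mult_up k : mult (up k) = k`!%:R.
Proof. by case: k => [|k]; rewrite /mult ?big_nil // big_seq1. Qed.

Lemma thickenK a : thicken a ∘ thin a ≈ mult a *: Id a.
Proof.
elim: a => [|n a IH]; first by rewrite /mult big_nil scl1 cmp1l.
rewrite -[thicken (n :: a)]/(merges n.+1 ⊗ thicken a) -[thin (n :: a)]/(splits
  n.+1 ⊗ thin a) tnsM ?even_thicken ?thickenE ?thinE ?mergesE ?splitsE //.
rewrite merges_splits IH tnsZl tnsZr sclA tns_id.
by rewrite /mult big_cons natrM.
Qed.

Lemma thin_natural_thinK a : thin_natural (weight a) (weight a) (thin a ∘
  thicken a).
Proof.
elim: a => [|n a IH].
  by apply: thin_natural_transport (thin_natural_id _); rewrite /= cmp1l.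
apply: thin_natural_transport (thin_natural_tns (thin_natural_clasp n.+1) IH).
by rewrite -[thicken (n :: a)]/(merges n.+1 ⊗ thicken a) -[thin (n ::
  a)]/(splits n.+1 ⊗ thin a) tnsM ?even_thin ?thickenE ?thinE ?mergesE ?splitsE.
Qed.

(** Composing further with [thin a] on the right leaves the nonzero scalar [mult a]. *)
Lemma thicken_cancel a f g : f ∘ thicken a ≈ g ∘ thicken a ->
  src f = a -> src g = a -> f ≈ g.
Proof.
move=> e sf sg; apply: (meq_sclI (mult_neq0 a)).
rewrite -(cmp1r sf) -(cmp1r sg) -!cmpZr -thickenK !cmpA.
by rewrite e.
Qed.

Definition lifts t := exists2 f, thin_natural (weight (src t)) (weight (tgt t))
  f &
  t ∘ thicken (src t) ≈ thicken (tgt t) ∘ f.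

End Thick.

(** * Lifting morphisms to bundles, and the braiding of arbitrary objects *)

Section Lift.
Context {K : numFieldType}.
Implicit Types (f g h t u : term K) (k l m n p : nat) (a b : wobj).
Local Open Scope web_scope.

(** The sum over the k strands of a dot on that strand: merges turn a thick dot into it, as dots act
    by the Leibniz rule. *)
Fixpoint dots k : term K :=
  if k is n.+1 then dots n ⊗ \I_1 + \I_n ⊗ wdot 1 else Zero [::] [::].

Lemma thin_natural_dots k : thin_natural k k (dots k).
Proof.
elim: k => [|k IH]; first exact: (thin_natural_zero 0 0).
have := thin_natural_add (thin_natural_tnsr 1 IH) (thin_natural_tnsl k
  thin_natural_dot).
by rewrite addn1.
Qed.

Lemma dot_merges k : wdot k ∘ merges k ≈ merges k ∘ dots k.
Proof.
elim: k => [|k IH]; first by rewrite cmp1l // cmp1r.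
have [sd td _] := thin_natural_dots k.
rewrite mergesS cmpA -[X in wdot X]addn1 (meq_relation (web_dot_merge k 1)).
rewrite -!cmpA; apply: cmp_mor => //.
rewrite cmpDl cmp_tnsr IH -cmp_tnsr cmpDr; apply: add_mor => //.
by rewrite !tnsM ?cmp1l ?cmp1r ?mergesE ?even_merges ?orbT.
Qed.

(** The clasp ends in [splits k ⊗ splits l]; closing these with merges produces the factor k! l!,
    which the scalar removes. *)
Lemma lift_split k l : wsplit k l ∘ merges (k + l) ≈
  ((merges k ⊗ merges l) ∘ (((k`! * l`!)%N%:R)^-1 *: clasp (k + l)) : term K).
Proof.
have nz : (k`! * l`!)%N%:R != 0%R :> K by rewrite pnatr_eq0 -lt0n muln_gt0
  !fact_gt0.
rewrite /clasp -splits_cat cmpZr !cmpA tnsM ?mergesE ?splitsE ?even_merges //.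
rewrite !merges_splits tnsZl tnsZr sclA -natrM tns_id cmpZl cmpZl sclA mulVf //
  scl1.
by rewrite cmp1l ?tyE.
Qed.

(** Identities and merges lift to identity bundles, a dot to [dots], a split to a multiple of a
    clasp; the operations lift termwise. *)
Lemma liftable t : wf t -> lifts t.
Proof.
elim: t => [a|k|k l|k l|f IHf g IHg|f IHf g IHg|a b|f IHf g IHg|c f IHf] /=.
- move=> _; exists \I_(weight a); first exact: thin_natural_id.
  by rewrite cmp1l ?cmp1r ?thickenE.
- move=> k0; exists (dots k); first by rewrite /= weight_up;
  apply: thin_natural_dots.
  by have := dot_merges k; rewrite /= !thicken_up /wdot k0.
- move=> kl; exists \I_(k + l)%N.
    by rewrite /= weight_cat !weight_up; apply: thin_natural_id.
  have := merges_cat (K := K) k l; rewrite /wmerge kl => e.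
  by rewrite /= thicken_cat !thicken_up cmp1r ?e ?mergesE.
- move=> kl; exists ((k`! * l`!)%N%:R^-1 *: clasp (k + l)).
    by rewrite /= weight_cat !weight_up;
      apply/thin_natural_scl/thin_natural_clasp.
  have := lift_split k l; rewrite /wsplit kl => e.
  by rewrite /= thicken_cat !thicken_up.
- case/and3P=> /IHf[f' nf ef] /IHg[g' ng eg] /eqP e.
  exists (f' ∘ g'); first by apply: thin_natural_cmp ng; rewrite -e.
  by rewrite -[src (_ ∘ _)]/(src g) -cmpA eg -e cmpA ef cmpA.
- case/andP=> /IHf[f' nf ef] /IHg[g' ng eg].
  have [sf tf _] := nf; have [sg tg _] := ng.
  exists (f' ⊗ g'); first by rewrite /= !weight_cat; apply: thin_natural_tns.
  rewrite /= !thicken_cat !tnsM ?even_thicken ?orbT ?thickenE ?sf ?sg ?tf ?tg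
    //.
  by rewrite ef eg.
- move=> _; exists (Zero (ones (weight a)) (ones (weight b))).
    exact: thin_natural_zero.
  have z x y : (Zero x y : term K) ≈ 0%R *: Zero x y.
    by split=> // _; apply: weq_scl_zero.
  rewrite [src _]/= [tgt _]/= (z a) (z (ones _)) cmpZl cmpZr;
    apply: (@scl0 _ (ones (weight a)) b).
    exact: typed_cmp (typed_zero _ _) (typed_thicken _).
  exact: typed_cmp (typed_thicken _) (typed_zero _ _).
- case/and4P=> /IHf[f' nf ef] /IHg[g' ng eg] /eqP es /eqP et.
  rewrite -es -et in ng eg.
  exists (f' + g'); first exact: thin_natural_add.
  by rewrite /= cmpDl cmpDr ef eg.
- move=> /IHf[f' nf ef]; exists (c *: f'); first exact: thin_natural_scl.
  by rewrite /= cmpZl cmpZr ef.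
Qed.

(** The formula of [beta1] applied to whole words at once. *)
Definition braid a b : term K := (mult a * mult b)%R^-1 *:
  ((thicken b ⊗ thicken a) ∘ block_crossing (weight a) (weight b) ∘
   (thin a ⊗ thin b)).

Lemma typed_braid a b : typed (a ++ b) (b ++ a) (braid a b).
Proof.
by rewrite /typed /braid /= !(blockE, thickenE, thinE) !ones_cat [(weight b +
  _)%N]addnC !eqxx.
Qed.

Definition braidE a b := typedE (typed_braid a b).

Lemma even_braid a b : has_parity (braid a b) false.
Proof. by rewrite /braid /= !(even_thicken, even_thin, even_block). Qed.


(** The factors thin-after-thicken are natural, so they slide through the block crossing; there they
    meet the final merges and produce the scalar [mult a * mult b], which cancels the
    normalization. *)
Lemma braid_thicken a b : braid a b ∘ (thicken a ⊗ thicken b) ≈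
  (thicken b ⊗ thicken a) ∘ block_crossing (weight a) (weight b).
Proof.
have na := thin_natural_thinK (K := K) a;
  have nb := thin_natural_thinK (K := K) b.
have nz : (mult a * mult b)%R != 0%R :> K by rewrite mulf_neq0 ?mult_neq0.
apply: (meq_sclI nz); rewrite /braid cmpZl sclA mulfV // scl1.
rewrite -cmpA tnsM ?even_thin ?thinE ?thickenE //.
have [sa ta ea] := na; have [sb tb eb] := nb.
rewrite (tns_split tb sa) -cmpA [block_crossing _ _ ∘ _]cmpA ea -cmpA.
rewrite (thin_natural_r _ nb) !cmpA.
rewrite -cmpZl; apply: cmp_mor => //.
rewrite !tnsM /= ?even_thicken ?even_thin ?thickenE ?thinE ?orbT //.
rewrite cmp1r ?thickenE // !cmpA !thickenK !cmpZl !cmp1l ?thickenE //.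
by rewrite tnsZl tnsZr sclA mulrC cmp1r ?thickenE.
Qed.

Opaque braid.

Lemma thicken_cancel2 a b f g :
    f ∘ (thicken a ⊗ thicken b) ≈ g ∘ (thicken a ⊗ thicken b) ->
  src f = a ++ b -> src g = a ++ b -> f ≈ g.
Proof. by rewrite -thicken_cat; apply: thicken_cancel. Qed.

Lemma braid_invol a b : braid b a ∘ braid a b ≈ Id (a ++ b).
Proof.
apply: (@thicken_cancel2 a b); rewrite /= ?braidE //.
rewrite -cmpA braid_thicken cmpA braid_thicken -cmpA block_crossing_invol.
by rewrite cmp1l ?cmp1r //= ?thickenE ?ones_cat.
Qed.

(** Precomposed with the merges, [t] is replaced by its lift, which is natural for block
    crossings. *)
Lemma braid_natural_l t c : wf t ->
  braid (tgt t) c ∘ (t ⊗ Id c) ≈ (Id c ⊗ t) ∘ braid (src t) c.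
Proof.
move=> /liftable[f nf ef]; have [sf tf e] := nf.
apply: (@thicken_cancel2 (src t) c); rewrite /= ?braidE //.
rewrite -!cmpA braid_thicken tnsM ?thickenE ?even_thicken ?orbT // ef cmp1l
  ?thickenE //.
rewrite -[thicken c as X in _ ∘ (_ ⊗ X) ≈ _](@cmp1r _ (ones (weight c)))
  ?thickenE //.
rewrite -(tnsM (f := thicken (tgt t)) (g := thicken c)) ?thickenE ?even_thicken
  ?tf //.
rewrite cmpA braid_thicken -cmpA e !cmpA.
rewrite !tnsM ?thickenE ?even_thicken ?orbT ?tf //.
by rewrite -ef cmp1l ?cmp1r ?thickenE.
Qed.

Lemma braid_natural_r t c : wf t ->
  braid c (tgt t) ∘ (Id c ⊗ t) ≈ (t ⊗ Id c) ∘ braid c (src t).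
Proof.
move=> wt; rewrite -[Id c ⊗ t](@cmp1r _ (c ++ src t)) //.
rewrite -(braid_invol c (src t)) [_ ∘ (braid _ _ ∘ _)]cmpA -braid_natural_l //.
by rewrite !cmpA braid_invol cmp1l.
Qed.

Lemma braid_hexr a b c :
  braid a (b ++ c) ≈ (Id b ⊗ braid a c) ∘ (braid a b ⊗ Id c).
Proof.
apply: (@thicken_cancel2 a (b ++ c)); rewrite /= ?braidE ?catA //.
rewrite braid_thicken !thicken_cat weight_cat block_crossing_hexr.
rewrite -[_ ∘ (thicken a ⊗ _)]cmpA [thicken a ⊗ _]tnsA.
rewrite [(braid a b ⊗ _) ∘ _]tnsM /= ?braidE ?thickenE ?even_thicken //.
rewrite braid_thicken.
rewrite [Id c ∘ _]cmp1l ?thickenE //.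
rewrite -[thicken c as X in _ ≈ _ ∘ (_ ⊗ X)](@cmp1r _ (ones (weight c)))
  ?thickenE //.
rewrite -[X in _ ≈ _ ∘ X]tnsM /= ?thickenE ?blockE ?ones_cat ?even_thicken
  ?even_block ?orbT //; try by rewrite addnC.
rewrite !cmpA -[(thicken b ⊗ thicken a) ⊗ _]tnsA [(Id b ⊗ _) ∘ _]tnsM /=
  ?braidE ?thickenE ?even_braid ?even_thicken ?orbT //.
rewrite braid_thicken cmp1l ?thickenE //.
rewrite -[thicken b as X in _ ≈ (X ⊗ _) ∘ _](@cmp1r _ (ones (weight b)))
  ?thickenE //.
rewrite -[X in _ ≈ X ∘ _]tnsM /= ?thickenE ?blockE ?ones_cat ?even_thicken
  ?even_block ?orbT //; try by rewrite addnC.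
by rewrite tnsA.
Qed.

Lemma braid_hexl a b c :
  braid (a ++ b) c ≈ (braid a c ⊗ Id b) ∘ (Id a ⊗ braid b c).
Proof.
apply: (@thicken_cancel2 (a ++ b) c); rewrite /= ?braidE ?catA //.
rewrite braid_thicken !thicken_cat weight_cat block_crossing_hexl.
rewrite -[_ ∘ (_ ⊗ thicken c)]cmpA -[_ ⊗ thicken c]tnsA.
rewrite [(Id a ⊗ _) ∘ _]tnsM /= ?braidE ?thickenE ?even_braid ?even_thicken
  ?orbT //.
rewrite braid_thicken cmp1l ?thickenE //.
rewrite -[thicken a as X in _ ≈ _ ∘ (X ⊗ _)](@cmp1r _ (ones (weight a)))
  ?thickenE //.
rewrite -[X in _ ≈ _ ∘ X]tnsM /= ?thickenE ?blockE ?ones_cat ?even_thicken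
  ?even_block ?orbT //; try by rewrite addnC.
rewrite !cmpA [thicken a ⊗ (thicken c ⊗ _)]tnsA [(_ ⊗ Id b) ∘ _]tnsM /= ?braidE
  ?thickenE ?even_braid ?even_thicken ?orbT //.
rewrite braid_thicken cmp1l ?thickenE //.
rewrite -[thicken b as X in _ ≈ (_ ⊗ X) ∘ _](@cmp1r _ (ones (weight b)))
  ?thickenE //.
rewrite -[X in _ ≈ X ∘ _]tnsM /= ?thickenE ?blockE ?ones_cat ?even_thicken
  ?even_block ?orbT //; try by rewrite addnC.
by rewrite tnsA.
Qed.

End Lift.

(** * The braiding *)

Section Beta.
Context {K : numFieldType}.
Implicit Types (t u : term K) (k l : nat) (a b c : wobj).
Local Open Scope web_scope.

Lemma braid_unit_l b : (braid [::] b : term K) ≈ Id b.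
Proof.
rewrite /braid block_crossing0l tns1r tns1l cmp1r ?thickenE // thickenK sclA.
by rewrite [mult [::]]/mult big_nil mul1r mulVf ?mult_neq0 // scl1.
Qed.

Lemma braid_unit_r a : (braid a [::] : term K) ≈ Id a.
Proof.
rewrite /braid block_crossing0r tns1r tns1l cmp1r ?thickenE // thickenK sclA.
by rewrite [mult [::]]/mult big_nil mulr1 mulVf ?mult_neq0 // scl1.
Qed.

Lemma beta1_braid k l : (beta1 k l : term K) ≈ braid (up k) (up l).
Proof.
rewrite /beta1; case: ifPn => [_|].
  by rewrite /braid !thicken_up !thin_up !weight_up !mult_up natrM.
rewrite negb_and -!leqNgt !leqn0 => /orP[]/eqP->.
  by rewrite tns1l braid_unit_l.
by rewrite tns1r braid_unit_r.
Qed.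

Lemma beta_strand_braid k (b : seq nat) :
  (beta_strand k b : term K) ≈ braid (up k) (ups b).
Proof.
elim: b => [|l b IH]; first by rewrite braid_unit_r.
by rewrite [beta_strand _ _]/= IH beta1_braid -braid_hexr.
Qed.

(** The recursions defining [beta_strand] and [beta_tuple] are the two hexagons with one strand
    split off. *)
Lemma beta_tuple_braid (a b : seq nat) :
  (beta_tuple a b : term K) ≈ braid (ups a) (ups b).
Proof.
elim: a => [|k a IH]; first by rewrite braid_unit_l.
by rewrite [beta_tuple _ _]/= IH beta_strand_braid -braid_hexl.
Qed.

Lemma wclass_meq a b t u (ht : typed a b t) (hu : typed a b u) :
  t ≈ u -> wclass ht = wclass hu.
Proof. by case=> _ _ _ h; apply/wclassP/h; case/and3P: ht. Qed.

(** Associators are thus classes of identity expressions and disappear from the hexagons by the unit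
    laws. *)
Lemma eqhomE a b (e : a = b) : exists h : typed a b (Id a : term K),
  @eqhom K (qWeb K) a b e = wclass h.
Proof. by case: b / e; exists (typed_id a). Qed.

Opaque braid.

(** Defined on words: tuples that differ only by zero entries name the same object and must share a
    component. *)
Definition web_braid a b : @schom K (qWeb K) (a ++ b) (b ++ a) :=
  wclass (typed_braid a b).

Lemma web_braidK a b :
  sccomp (web_braid b a) (web_braid a b) = scid (a ++ b : qWeb K).
Proof.
by rewrite /= whom_compE; apply/wclass_meq/braid_invol.
Qed.

Lemma web_braid_supernatural : @is_supernatural K (qWeb K) web_braid.
Proof.
split=> [a b|a b c d p q _ _ [t [ht [pt ->]]] [u [hu [pu ->]]]].
  by exists (braid a b), (typed_braid a b); rewrite even_braid.
rewrite /= !whom_tensE !whom_compE wclassZ; apply: wclass_meq.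
have [[wt st] tt] := typedE ht; have [[wu su] tu] := typedE hu.
rewrite (tns_split tu st) cmpA.
have := braid_natural_l d wt; rewrite st tt => ->.
have := braid_natural_r a wu; rewrite su tu -cmpA => ->.
(* The two one-sided slides carry no sign; it appears here, when the factors are recombined in the
   opposite order. *)
rewrite cmpA (meq_interchange _ _ pt pu) ?tu ?st // cmp1l // cmp1r // cmpZl.
by [].
Qed.

Lemma web_braid_hexagon1 : @hexagon1 K (qWeb K) web_braid.
Proof.
move=> a b c.
have [h1 ->] := eqhomE (smobjA (b : qWeb K) c a).
have [h2 ->] := eqhomE (smobjA (a : qWeb K) b c).
have [h3 ->] := eqhomE (smobjA (b : qWeb K) a c).
rewrite /= /web_braid /whom_id /smobj /= !whom_tensE !whom_compE;
  apply: wclass_meq.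
by rewrite braid_hexr !cmp1l ?cmp1r //= ?braidE ?catA.
Qed.

Lemma web_braid_hexagon2 : @hexagon2 K (qWeb K) web_braid.
Proof.
move=> a b c.
have [h1 ->] := eqhomE (esym (smobjA (c : qWeb K) a b)).
have [h2 ->] := eqhomE (esym (smobjA (a : qWeb K) b c)).
have [h3 ->] := eqhomE (esym (smobjA (a : qWeb K) c b)).
rewrite /= /web_braid /whom_id /smobj /= !whom_tensE !whom_compE;
  apply: wclass_meq.
by rewrite braid_hexl !cmp1l ?cmp1r //= ?braidE ?catA.
Qed.

Lemma web_braid_symmetric : @is_symmetric_braiding K (qWeb K) web_braid.
Proof.
split; last by move=> a b; split; apply: web_braidK.
split; [exact: web_braid_supernatural| |exact: web_braid_hexagon1|exact:
  web_braid_hexagon2].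
by move=> a b; exists (web_braid b a); split; apply: web_braidK.
Qed.

Lemma web_braid_beta (a b : seq nat) : web_braid (ups a) (ups b) = web_beta K a
  b.
Proof. by apply: wclass_meq; rewrite beta_tuple_braid. Qed.

End Beta.

Theorem theorem4p5p4 (R : realType) :
  exists gam : forall a b : qWeb R[i], schom (smobj a b) (smobj b a),
    (forall a b : seq nat, gam (ups a) (ups b) = web_beta R[i] a b) /\
    is_symmetric_braiding gam.
Proof.
exists (@web_braid R[i]); split; first exact: web_braid_beta.
exact: web_braid_symmetric.
Qed.
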